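(* Let $1<p<2$, $\tau\in\mathbb{R}$, $\beta\ge0$, let $G$ be the martingale transform of $F$, and let $|\mathbb{E}G|\le\beta|\mathbb{E}F|$. Set $\beta'=\frac{\beta-1}{\beta+1}$. (i) If $u\left(\frac1{p-1}\right)\le0$, then $$\mathbb{E}(\tau^2F^2+G^2)^{p/2}\le\left(\tau^2+\max\left\{\beta,\frac1{p-1}\right\}^2\right)^{p/2}\mathbb{E}|F|^p .$$ (ii) If $u\left(\frac1{p-1}\right)>0$, then $$\mathbb{E}(\tau^2F^2+G^2)^{p/2}\le C(\beta')\,\mathbb{E}|F|^p,$$ where $C(\beta')$ is continuous, nondecreasing, and defined by $$C(\beta')=\begin{cases}(\tau^2+\beta^2)^{p/2},&\beta'\ge s^*;\\[2mm] \dfrac{|\tau|^p}{1-\frac{2^{2-p}(1-s_0)^{p-1}}{(\tau^2+1)(p-1)(1-s_0)+2(2-p)}},&\beta'\le-1+\frac2p;\\[4mm] \dfrac{f'(s_1)-f'(a(s_1))}{g'(s_1)-g'(a(s_1))},&-1+\frac2p<\beta'<s^*,\ \text{ where } s_1\in(\beta',s_0)\text{ solves }R(s_1,\beta')=0.\end{cases}$$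
   Context: $F,G$ are real-valued integrable functions on $[0,1]$, $\mathbb{E}F=\int_0^1F$, $F_n=\mathbb{E}(F|\mathcal{M}_n)$, $G_n=\mathbb{E}(G|\mathcal{M}_n)$, where $\{\mathcal{M}_n\}_{n\ge0}$ is the dyadic filtration of $[0,1]$. $G$ is called the martingale transform of $F$ if $|G_{n+1}-G_n|=|F_{n+1}-F_n|$ for all $n\ge0$. Definition of $u$: $$u(z)=|\tau|^p(p-1)(\tau^2+z^2)^{(2-p)/2}-\tau^2(p-1)+(1+z)^{2-p}-z(2-p)-1 .$$ In case (ii), $s_0\in(-1+2/p,1)$ is the solution of $u\left(\frac{1+s_0}{1-s_0}\right)=0$. For $t\in[-1,1]$ put $g(t)=(1-t)^p$ and $f(t)=\left((1+t)^2+\tau^2(1-t)^2\right)^{p/2}$. For $\tau\ne0$ there is a unique point $c\in(-1,1)$ at which $f'''g''-g'''f''$ (which has the sign of the torsion of the curve $(t,g(t),f(t))$) changes sign from $+$ to $-$; moreover $c<-1+2/p$ and $c<s_0$. The function $a$ is the unique function in $C([c,s_0])\cap C^1((c,s_0])$ with $a(c)=c$, $a(s_0)=-1$, $a'<0$ on $(c,s_0]$, such that for every $s\in[c,s_0]$ $$\begin{vmatrix}1&1&a(s)-s\\ g'(a(s))&g'(s)&g(a(s))-g(s)\\ f'(a(s))&f'(s)&f(a(s))-f(s)\end{vmatrix}=0 .$$ For $z\in[-1+2/p,s^*]$ and $s\in[z,s_0]$ put $$R(s,z)=-f(s)-\frac{f'(a(s))g'(s)-f'(s)g'(a(s))}{g'(s)-g'(a(s))}(z-s)+\frac{f'(s)-f'(a(s))}{g'(s)-g'(a(s))}\,g(s).$$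 The number $s^*\in[-1+2/p,s_0]$ is the solution of $\frac{f'(s^* )-f'(a(s^* ))}{g'(s^* )-g'(a(s^* ))}=\frac{f(s^* )}{g(s^* )}$. *)

(* Defs.v *)
From HB Require Import structures.
From mathcomp Require Import all_boot all_order all_algebra.
From mathcomp Require Import all_classical all_reals all_analysis.

Set Implicit Arguments.
Unset Strict Implicit.
Unset Printing Implicit Defensive.

Import Order.TTheory GRing.Theory Num.Theory.
Import numFieldNormedType.Exports.

Local Open Scope classical_set_scope.
Local Open Scope ring_scope.

Section MartingaleTransform.
Context {R : realType}.
Local Notation mu := (@lebesgue_measure R).
Implicit Types (F G Y : R -> R).

Definition expect F : R := \int[mu]_(x in `[0, 1]) F x.

(* Expectation of a nonnegative function; may be +oo. *)
Definition nnexpect F : \bar R := (\int[mu]_(x in `[0%R, 1%R]) (F x)%:E)%E.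

Definition integrable01 F : Prop := mu.-integrable `[0, 1] (EFin \o F).

(* Half-open dyadic intervals leave out only the null set [set 1], which is
   then an extra atom of every sigma-algebra of the filtration. *)
Definition dyadic_interval (n k : nat) : set R :=
  `[k%:R / 2 ^+ n, k.+1%:R / 2 ^+ n[.

Definition dyadic_sigma (n : nat) : set (set R) :=
  <<s `[0, 1], [set dyadic_interval n k | k in [set k | (k < 2 ^ n)%N]] >>.

(* Y is a version of the conditional expectation of F with respect to the
   sigma-algebra M on [0, 1]. *)
Definition is_cond_expect (M : set (set R)) F Y : Prop :=
  [/\ forall B : set R, measurable B -> M (`[0, 1] `&` Y @^-1` B),
      integrable01 Y
    & forall A : set R, M A ->
        \int[mu]_(x in A) Y x = \int[mu]_(x in A) F x].

(* Conditional expectations are unique only almost everywhere, hence the choice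
   of versions and the almost-everywhere equality. *)
Definition martingale_transform F G : Prop :=
  exists Fn Gn : nat -> R -> R,
    [/\ forall n, is_cond_expect (dyadic_sigma n) F (Fn n),
        forall n, is_cond_expect (dyadic_sigma n) G (Gn n)
      & forall n, {ae mu, forall x, x \in `[0, 1] ->
          `|Gn n.+1 x - Gn n x| = `|Fn n.+1 x - Fn n x|}].

Definition transform_bound (p tau beta K : R) : Prop :=
  forall F G, integrable01 F -> integrable01 G ->
    martingale_transform F G ->
    `|expect G| <= beta * `|expect F| ->
    (nnexpect (fun x => (tau ^+ 2 * F x ^+ 2 + G x ^+ 2) `^ (p / 2))%R
       <= K%:E * nnexpect (fun x => `|F x| `^ p)%R)%E.

End MartingaleTransform.

Section SharpConstant.
Context {R : realType}.
Variables (p tau : R).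

Definition u (z : R) : R :=
  `|tau| `^ p * (p - 1) * (tau ^+ 2 + z ^+ 2) `^ ((2 - p) / 2)
  - tau ^+ 2 * (p - 1) + (1 + z) `^ (2 - p) - z * (2 - p) - 1.

(* Only the values on [-1, 1] matter; the formulas are differentiable across
   -1 (for tau != 0), so the one-sided derivatives there are ordinary ones. *)
Definition g (t : R) : R := (1 - t) `^ p.
Definition f (t : R) : R :=
  ((1 + t) ^+ 2 + tau ^+ 2 * (1 - t) ^+ 2) `^ (p / 2).

Definition is_s0 (s0 : R) : Prop :=
  -1 + 2 / p < s0 < 1 /\ u ((1 + s0) / (1 - s0)) = 0.

Definition torsion (t : R) : R :=
  f^`(3)%classic t * g^`(2)%classic t - g^`(3)%classic t * f^`(2)%classic t.

Definition is_cup_origin (c : R) : Prop :=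
  [/\ -1 < c < 1,
      \forall t \near c^'-, 0 < torsion t
    & \forall t \near c^'+, torsion t < 0].

Definition cup_matrix (x s : R) : 'M[R]_3 :=
  \matrix_(i < 3, j < 3) nth 0 (nth [::]
    [:: [:: 1; 1; x - s];
        [:: g^`()%classic x; g^`()%classic s; g x - g s];
        [:: f^`()%classic x; f^`()%classic s; f x - f s]] i) j.

(* The derivative a' on ]c, s0] is relative to that interval, i.e. it is
   the left derivative at s0. *)
Definition is_cup_function (c s0 : R) (a : R -> R) : Prop :=
  [/\ {within `[c, s0], continuous a},
      exists a' : R -> R,
        [/\ {within `]c, s0], continuous a'},
            forall s, c < s <= s0 ->
              (a t - a s) / (t - s) @[t --> within `]c, s0] s^'] --> a' s
          & forall s, c < s <= s0 -> a' s < 0],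
      a c = c, a s0 = -1
    & forall s, c <= s <= s0 -> \det (cup_matrix (a s) s) = 0].

Section WithCup.
Variables (s0 c : R) (a : R -> R).

Definition slope (s : R) : R :=
  (f^`()%classic s - f^`()%classic (a s))
  / (g^`()%classic s - g^`()%classic (a s)).

Definition Rfun (s z : R) : R :=
  - f s
  - (f^`()%classic (a s) * g^`()%classic s
     - f^`()%classic s * g^`()%classic (a s))
    / (g^`()%classic s - g^`()%classic (a s)) * (z - s)
  + slope s * g s.

(* The bound c <= sstar says that sstar lies in the domain [c, s0] of a; it is
   redundant when c < -1 + 2 / p. *)
Definition is_sstar (sstar : R) : Prop :=
  [/\ -1 + 2 / p <= sstar <= s0, c <= sstar & slope sstar = f sstar / g sstar].

(* As beta ranges over [0, +oo[, beta' ranges over [-1, 1[, so C is determined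
   on [-1, 1[. The constraint c <= s1 in the last case again keeps s1 in the
   domain of a; the value must not depend on the choice of the solution s1. *)
Definition is_constant (sstar : R) (C : R -> R) : Prop :=
  forall beta : R, 0 <= beta -> let beta' := (beta - 1) / (beta + 1) in
  [/\ sstar <= beta' -> C beta' = (tau ^+ 2 + beta ^+ 2) `^ (p / 2),
      beta' <= -1 + 2 / p ->
        C beta' = `|tau| `^ p /
          (1 - 2 `^ (2 - p) * (1 - s0) `^ (p - 1) /
               ((tau ^+ 2 + 1) * (p - 1) * (1 - s0) + 2 * (2 - p)))
    & -1 + 2 / p < beta' < sstar ->
        (exists s1, [/\ beta' < s1 < s0, c <= s1 & Rfun s1 beta' = 0]) /\
        (forall s1, beta' < s1 < s0 -> c <= s1 -> Rfun s1 beta' = 0 ->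
           C beta' = slope s1)].

End WithCup.
End SharpConstant.

(* Main.v *)
(** The pair (F_n, G_n) moves along segments of slope 1 or -1, and along such
    segments Burkholder's function (|x| + |y|)^(p-1) (|y| - b |x|) is midpoint
    concave as soon as b >= 1 / (p - 1).  Hence K is a valid constant whenever
    (tau^2 x^2 + y^2)^(p/2) - K |x|^p is at most a nonnegative multiple of this
    function with b >= beta.  By homogeneity this is a condition on the segment
    (x, y) = (1 - t, 1 + t): the graph of f - K g lies below some line
    vanishing at z, where z >= -1 + 2 / p corresponds to b.  The constant of
    the theorem is the least K for which such a line exists.  If
    u (1 / (p - 1)) <= 0, the tangent at z does the job.  Otherwise, because
    f'' / g'' increases and then decreases, a line tangent to f - K g at both
    a s and s lies above it: for z = -1 + 2 / p it touches at -1 and s0, for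
    larger z at a s1 and s1, and from sstar on the tangent at z is optimal.
    A line that is admissible for z is admissible for all smaller z, and a
    small change of z is compensated by a small change of K, so that the least
    K is a nondecreasing and continuous function of z. *)

Require Import Defs.
From HB Require Import structures.
From mathcomp Require Import all_boot all_order all_algebra.
From mathcomp Require Import all_classical all_reals all_analysis.
From mathcomp Require Import measurable_realfun.
From mathcomp Require Import ring lra.

Set Implicit Arguments.
Unset Strict Implicit.
Unset Printing Implicit Defensive.

Import Order.TTheory GRing.Theory Num.Theory.
Import numFieldNormedType.Exports.

Local Open Scope classical_set_scope.
Local Open Scope ring_scope.

(** * Calculus *)

Section Calculus.
Context {R : realType}.
Implicit Types (h dh : R -> R) (a b x : R).

(** Taking the constant to be a minimum avoids any study of how s1 moves with z: every solution of
    [Rfun s1 z = 0] yields a minimal K for the same z, and minimal values coincide. The price is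
    that minimality requires the root z to lie strictly between the contact points, and a s1 < z is
    the delicate inequality ([contact_lt_root]). The number -1 + 2 / p plays two independent roles.
    It is the t at which [ratio t] reaches 1 / (p - 1), the concavity threshold of Burkholder's
    function. For tau != 0 it is also a zero of every line tangent at -1 to some f - K g, because f
    and g both satisfy h' = -(p / 2) h at -1; this is why the cup whose left end is -1 belongs to
    this z. On the probabilistic side F and G are merely integrable, so expectations may be
    infinite. The inequality is proved for the step functions F_n and G_n, where everything is a
    finite sum, and passes to the limit by Fatou's lemma. Almost everywhere convergence is Lebesgue
    differentiation along dyadic intervals. *)

Lemma is_derive_powR_comp h (x dhx a : R) : is_derive x 1 h dhx -> 0 < h x ->
  is_derive x 1 (fun t => h t `^ a) (a * h x `^ (a - 1) * dhx).
Proof.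
move=> hx hx0.
have := @is_derive1_comp R (fun y => y `^ a) h x _ _ (is_derive1_powR a hx0) hx.
by [].
Qed.

Lemma is_derive_continuous h (t d : R) : is_derive t 1 h d -> {for t, continuous h}.
Proof. by case=> ? _; exact/differentiable_continuous/derivable1_diffP. Qed.

Lemma mvt h dh a b : a < b ->
  (forall x, a <= x <= b -> is_derive x 1 h (dh x)) ->
  exists2 c, a < c < b & h b - h a = dh c * (b - a).
Proof.
move=> ab hdh.
have [||c] := @MVT R h dh a b ab.
- by move=> x /[!in_itv]/= /andP[/ltW ax /ltW xb]; apply: hdh; rewrite ax xb.
- apply: derivable_within_continuous => x /[!in_itv]/= xab.
  by have [] := hdh x xab.
- by rewrite in_itv/=; exists c.
Qed.

Lemma tangent_bounds h dh a b : a <= b ->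
  (forall x, a <= x <= b -> is_derive x 1 h (dh x)) ->
  (forall x y, a <= x -> x <= y -> y <= b -> dh y <= dh x) ->
  dh b * (b - a) <= h b - h a <= dh a * (b - a).
Proof.
rewrite le_eqVlt => /predU1P[->|ab] hdh mono; first by rewrite !subrr !mulr0 lexx.
have [c /andP[ac cb] ->] := mvt ab hdh.
by rewrite !ler_pM2r ?subr_gt0//; apply/andP; split; apply: mono; rewrite ?lexx ?ltW.
Qed.

Lemma powRS (w a : R) : 0 < w -> w `^ (a + 1) = w * w `^ a.
Proof.
move=> w0; rewrite powRD; last by rewrite (gt_eqF w0) implybT.
by rewrite powRr1 ?ltW// mulrC.
Qed.

Lemma powR_nincr (a : R) : a <= 0 ->
  forall x y : R, 0 < x -> x <= y -> y `^ a <= x `^ a.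
Proof.
move=> a0 x y x0 xy; have y0 := lt_le_trans x0 xy.
rewrite -(opprK a) !(powRN _ (- a)) lef_pV2 ?posrE ?powR_gt0//.
by apply: ge0_ler_powR; rewrite ?nnegrE ?oppr_ge0// ltW.
Qed.

(** The supporting line comes from Young's inequality for |x| and |m|^(p-1) with exponents p and p /
    (p - 1). It serves both for midpoint convexity and for Jensen's inequality. *)
Lemma powR_tangent (p m : R) : 1 < p ->
  exists l : R, forall x, `|m| `^ p + l * (x - m) <= `|x| `^ p.
Proof.
move=> p1; have p0 : 0 < p by exact: lt_trans p1.
exists (p * `|m| `^ (p - 1) * Num.sg m) => x.
have q0 : 0 < p / (p - 1) by rewrite divr_gt0//; lra.
have pq : p^-1 + (p / (p - 1))^-1 = 1 by field; lra.
have := conjugate_powR (normr_ge0 x) (powR_ge0 `|m| (p - 1)) p0 q0 pq.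
rewrite -powRrM (_ : (p - 1) * (p / (p - 1)) = p); last by field; lra.
rewrite (_ : (p / (p - 1))^-1 = (p - 1) / p); last by field; lra.
have := mulr_powRB1 (normr_ge0 m) p0.
set M := `|m| `^ (p - 1); set Mp := `|m| `^ p; set X := `|x| `^ p => MM H.
have H2 : p * (`|x| * M) <= X + Mp * (p - 1).
  have : p * (`|x| * M) <= p * (X / p + Mp * ((p - 1) / p)) by rewrite ler_pM2l.
  by rewrite (_ : p * (X / p + _) = X + Mp * (p - 1))//; field; lra.
have H3 : Num.sg m * x <= `|x|.
  have [_|_|_] := sgrP m; rewrite ?mul0r ?mul1r ?mulN1r ?ler_norm//.
  by rewrite -normrN ler_norm.
have H4 : Num.sg m * m = `|m| by rewrite normrEsg.
have M0 : 0 <= p * M by rewrite mulr_ge0 ?powR_ge0// ltW.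
have H5 := ler_wpM2l M0 H3.
have -> : p * M * Num.sg m * (x - m) = p * M * (Num.sg m * x) - p * (`|m| * M).
  by rewrite -H4; ring.
rewrite MM; lra.
Qed.

End Calculus.

(** * Burkholder's function *)

Section Burkholder.
Context {R : realType}.
Variables (p b : R).
Hypothesis hp : 1 < p < 2.
Hypothesis hb : 1 <= b * (p - 1).

Definition burkholder (x y : R) : R := (`|x| + `|y|) `^ (p - 1) * (`|y| - b * `|x|).

Let gt1_b : 1 < b.
Proof.
move/andP: hp => [p1 p2]; rewrite ltNge; apply/negP => b1.
have : 0 <= (1 - b) * (p - 1) by rewrite mulr_ge0; lra.
by move: hb; lra.
Qed.

(** * Concavity along the lines y - x = c *)

Section line.
Variable c : R.
Hypothesis c0 : 0 < c.

(** In the coordinate v = x + y on the line y - x = c, these are the expressions of twice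
    [burkholder]: [kR] where x and y are nonnegative, [kM] where x <= 0 <= y, [kL] where both are
    nonpositive. *)
Let kR v := v `^ (p - 1) * ((1 + b) * c - (b - 1) * v).
Let dR v := (p - 1) * (1 + b) * c * v `^ (p - 2) - p * (b - 1) * v `^ (p - 1).
Let kM v := c `^ (p - 1) * ((1 + b) * v - (b - 1) * c).
Let dM := c `^ (p - 1) * (1 + b).
Let kL v := (- v) `^ (p - 1) * ((b - 1) * v - (1 + b) * c).
Let dL v := (p - 1) * (1 + b) * c * (- v) `^ (p - 2) + p * (b - 1) * (- v) `^ (p - 1).
Let k (v : R) := if v <= - c then kL v else if v <= c then kM v else kR v.
(** At the kinks -c and c this is the left derivative; for a concave function any one-sided
    derivative gives a supporting line. *)
Let dk (v : R) := if v <= - c then dL v else if v <= c then dM else dR v.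

Let pm (w : R) : 0 < w -> w `^ (p - 1) = w * w `^ (p - 2).
Proof. by move=> w0; rewrite -powRS//; congr (_ `^ _); lra. Qed.

Let derR (v : R) : 0 < v -> is_derive v 1 kR (dR v).
Proof.
have b1 := gt1_b; have cgt0 := c0.
move=> v0; rewrite /kR /dR; have H := is_derive1_powR (p - 1) v0.
apply: is_derive_eq.
rewrite /GRing.scale /=.
rewrite (_ : p - 1 - 1 = p - 2); last by lra.
by rewrite pm//; ring.
Qed.

Let derL (v : R) : v < 0 -> is_derive v 1 kL (dL v).
Proof.
have b1 := gt1_b; have cgt0 := c0.
move=> v0; have nv0 : 0 < - v by rewrite oppr_gt0.
have H : is_derive v 1 (fun t => (- t) `^ (p - 1)) ((p - 1) * (- v) `^ (p - 1 - 1) * (- 1)).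
  exact: is_derive_powR_comp.
rewrite /kL /dL.
apply: is_derive_eq.
rewrite ?scaler0 ?add0r /GRing.scale /=.
rewrite (_ : p - 1 - 1 = p - 2); last by lra.
by rewrite pm//; ring.
Qed.

Let dR_nincr (x y : R) : 0 < x -> x <= y -> dR y <= dR x.
Proof.
have b1 := gt1_b; have cgt0 := c0.
move=> x0 xy; rewrite /dR; move/andP: hp => [p1 p2].
apply: lerB.
  rewrite ler_wpM2l//; first by rewrite !mulr_ge0//; lra.
  by apply: powR_nincr => //; lra.
rewrite ler_wpM2l//; first by rewrite !mulr_ge0//; lra.
by apply: ge0_ler_powR; rewrite ?nnegrE; lra.
Qed.

Let dL_nincr (x y : R) : y <= - c -> x <= y -> dL y <= dL x.
Proof.
have b1 := gt1_b; have cgt0 := c0.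
move=> yc; rewrite le_eqVlt => /predU1P[->//|xy].
pose e w : R := (p - 1) * (1 + b) * c * w `^ (p - 2) + p * (b - 1) * w `^ (p - 1).
pose de w : R := (p - 1) * w `^ (p - 3) * (p * (b - 1) * w - (2 - p) * (1 + b) * c).
have [|w|w /andP[w1 w2]] := @mvt R e de (- y) (- x); first by lra.
  move=> /andP[wy wx]; have w0 : 0 < w by lra.
  have H1 := is_derive1_powR (p - 2) w0; have H2 := is_derive1_powR (p - 1) w0.
  rewrite /e /de; apply: is_derive_eq.
  rewrite ?scaler0 ?add0r /GRing.scale /=.
  have -> : p - 2 - 1 = p - 3 by lra.
  have -> : p - 1 - 1 = p - 3 + 1 by lra.
  by rewrite powRS//; ring.
rewrite /e -/(dL x) -/(dL y) => H.
rewrite -subr_ge0 H; move/andP: hp => [p1 p2].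
apply: mulr_ge0; last by lra.
apply: mulr_ge0; first by rewrite mulr_ge0 ?powR_ge0//; lra.
(* The bracket increases with w and equals 2 c (b (p - 1) - 1) at w = c, so [hb] is exactly what
   makes this branch concave. *)
have h1 : 0 <= p * (b - 1) * (w - c) by rewrite !mulr_ge0//; lra.
have h2 : 0 <= c * (b * (p - 1) - 1) by rewrite mulr_ge0// ?subr_ge0//; lra.
lra.
Qed.

(** The slope drops at -c by 2 c^(p-1) (b (p - 1) - 1): the threshold b >= 1 / (p - 1) shows up at
    the kink as well. *)
Let dL_ge (z : R) : z <= - c -> dM <= dL z.
Proof.
have b1 := gt1_b; have cgt0 := c0.
move=> zc; apply: le_trans (dL_nincr (lexx _) zc).
rewrite /dL /dM opprK pm//.
have := powR_gt0 (p - 2) c0; set om := c `^ _ => om0.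
rewrite -subr_ge0 (_ : _ - _ = om * (c * (2 * (b * (p - 1) - 1)))); last by ring.
by rewrite !mulr_ge0 ?subr_ge0 ?(ltW om0)//; lra.
Qed.

Let dR_le (z : R) : c <= z -> dR z <= dM.
Proof.
have b1 := gt1_b; have cgt0 := c0.
move=> cz; apply: le_trans (dR_nincr c0 cz) _.
rewrite /dR /dM pm//.
have := powR_gt0 (p - 2) c0; set om := c `^ _ => om0.
rewrite -subr_ge0 (_ : _ - _ = om * (c * (2 * (b + 1 - p)))); last by ring.
by move/andP: hp => [p1 p2]; rewrite !mulr_ge0 ?ltW//; lra.
Qed.

Let dk_nincr (x y : R) : x <= y -> dk y <= dk x.
Proof.
have b1 := gt1_b; have cgt0 := c0.
move=> xy; rewrite /dk.
have [yc|yc] := leP y (- c).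
  by rewrite (le_trans xy yc) dL_nincr.
have [xc|xc] := leP x (- c).
  have [yc'|yc'] := leP y c; first exact: dL_ge.
  by apply: le_trans (dL_ge xc); apply: dR_le; exact: ltW.
have [yc'|yc'] := leP y c; first by rewrite (le_trans xy yc').
have [xc'|xc'] := leP x c; first by apply: dR_le; exact: ltW.
by apply: dR_nincr => //; apply: lt_trans xc'.
Qed.

(** Supporting inequalities from both ends of [x, y]. As [dk] is monotone, they can be concatenated,
    so concavity is checked piece by piece. *)
Let P (x y : R) := dk y * (y - x) <= k y - k x <= dk x * (y - x).

Let P_trans (x y z : R) : x <= y -> y <= z -> P x y -> P y z -> P x z.
Proof.
have b1 := gt1_b; have cgt0 := c0.
rewrite /P => xy yz; have := dk_nincr xy; have := dk_nincr yz => H1 H2.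
by move=> /andP[h1 h2] /andP[h3 h4]; apply/andP; split; nra.
Qed.

Let P_left (x y : R) : x <= y -> y <= - c -> P x y.
Proof.
have b1 := gt1_b; have cgt0 := c0.
move=> xy yc; rewrite /P /k /dk yc (le_trans xy yc).
apply: tangent_bounds => //.
  by move=> z /andP[_ zy]; apply: derL; lra.
by move=> u v _ uv vy; apply: dL_nincr => //; lra.
Qed.

Let P_mid (x y : R) : x < y -> - c <= x -> y <= c -> P x y.
Proof.
have b1 := gt1_b; have cgt0 := c0.
move=> xy cx yc.
have kE v : - c <= v -> v <= c -> k v = kM v.
  move=> cv vc; rewrite /k; have [vc'|vc'] := leP v (- c); last by rewrite vc.
  have -> : v = - c by apply/eqP; rewrite eq_le vc' cv.
  by rewrite /kM /kL opprK; ring.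
rewrite /P !kE//; [|lra..].
rewrite /kM -mulrBr.
have -> : ((1 + b) * y - (b - 1) * c - ((1 + b) * x - (b - 1) * c)) = (1 + b) * (y - x) by ring.
rewrite mulrA -/(dM) !ler_pM2r ?subr_gt0// /dk (lt_geF (le_lt_trans cx xy)) yc lexx/=.
case: (leP x (- c)) => xc; first exact: dL_ge.
by rewrite (le_trans (ltW xy) yc).
Qed.

Let P_right (x y : R) : x < y -> c <= x -> P x y.
Proof.
have b1 := gt1_b; have cgt0 := c0.
move=> xy cx; move/andP: hp => [p1 p2].
have kE v : c <= v -> k v = kR v.
  move=> cv; rewrite /k (_ : (v <= - c) = false); last by apply/negbTE; rewrite -ltNge; lra.
  have [vc'|//] := leP v c.
  have -> : v = c by apply/eqP; rewrite eq_le vc' cv.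
  by rewrite /kM /kR.
have /andP[H1 H2] : dR y * (y - x) <= kR y - kR x <= dR x * (y - x).
  apply: tangent_bounds => //; first exact: ltW.
    by move=> z /andP[xz _]; apply: derR; lra.
  by move=> u v xu uv _; apply: dR_nincr => //; lra.
rewrite /P !kE//; last lra.
have F (u v : R) : v < u -> (u <= v) = false by move=> uv; apply/negbTE; rewrite -ltNge.
have [F1 F2 F3] : [/\ (y <= - c) = false, (y <= c) = false & (x <= - c) = false].
  by split; apply: F; lra.
rewrite /dk F1 F2 F3.
rewrite H1 /=; have [xc|//] := leP x c.
by apply: le_trans H2 _; rewrite ler_pM2r ?subr_gt0// dR_le.
Qed.

Let P_all (x y : R) : x < y -> P x y.
Proof.
have b1 := gt1_b; have cgt0 := c0.
move=> xy.
have PR u v : u < v -> - c <= u -> P u v.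
  move=> uv cu; have [vc|vc] := leP v c; first exact: P_mid.
  have [cu'|cu'] := leP c u; first exact: P_right.
  by apply: (@P_trans _ c); rewrite ?(ltW vc) ?(ltW cu')//; [exact: P_mid|exact: P_right].
have [yc|yc] := leP y (- c); first by apply: P_left => //; exact: ltW.
have [cx|cx] := leP (- c) x; first exact: PR.
by apply: (@P_trans _ (- c)); [lra|lra|apply: P_left => //; lra|apply: PR].
Qed.

Let k_midpoint (v d : R) : k (v + d) + k (v - d) <= 2 * k v.
Proof.
have b1 := gt1_b; have cgt0 := c0.
wlog d0 : d / 0 < d.
  move=> H; have [d0|d0|<-] := ltgtP 0 d; first exact: H.
    by have := H (- d); rewrite opprK addrC; apply; lra.
  by rewrite subr0 addr0; lra.
have /andP[_ H1] : P v (v + d) by apply: P_all; lra.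
have /andP[H2 _] : P (v - d) v by apply: P_all; lra.
have E1 : v + d - v = d by lra.
have E2 : v - (v - d) = d by lra.
rewrite E1 in H1; rewrite E2 in H2; lra.
Qed.

Let burkholder_line (x y : R) : y - x = c -> 2 * burkholder x y = k (x + y).
Proof.
have b1 := gt1_b; have cgt0 := c0.
move=> yx; have yE : y = x + c by lra.
rewrite /burkholder /k; have [h1|h1] := leP (x + y) (- c).
  rewrite ler0_norm; last lra.
  rewrite ler0_norm; last lra.
  by rewrite /kL (_ : - x - y = - (x + y)); [rewrite yE; ring|ring].
have [h2|h2] := leP (x + y) c.
  rewrite ler0_norm; last lra.
  rewrite ger0_norm; last lra.
  by rewrite /kM (_ : - x + y = c); [rewrite yE; ring|lra].
rewrite ger0_norm; last lra.
rewrite ger0_norm; last lra.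
by rewrite /kR yE; ring.
Qed.

Lemma burkholder_diag (x y : R) d : y - x = c ->
  burkholder (x + d) (y + d) + burkholder (x - d) (y - d) <= 2 * burkholder x y.
Proof.
have b1 := gt1_b; have cgt0 := c0.
move=> yx; have := k_midpoint (x + y) (2 * d).
have -> : x + y + 2 * d = (x + d) + (y + d) by ring.
have -> : x + y - 2 * d = (x - d) + (y - d) by ring.
by rewrite -!burkholder_line; lra.
Qed.

End line.

Lemma burkholderN x y : burkholder (- x) (- y) = burkholder x y.
Proof. by rewrite /burkholder !normrN. Qed.

Lemma burkholderNr x y : burkholder x (- y) = burkholder x y.
Proof. by rewrite /burkholder !normrN. Qed.

Lemma norm_powR_midpoint (x d : R) :
  2 * `|x| `^ p <= `|x + d| `^ p + `|x - d| `^ p.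
Proof.
have [p1 _] := andP hp; have [l hl] := powR_tangent x p1.
have := hl (x + d); have := hl (x - d).
have -> : x - d - x = - d by ring.
have -> : x + d - x = d by ring.
lra.
Qed.

(** Direction (1, 1) is [burkholder_diag], after a change of sign if y < x; on the diagonal the
    function is a nonpositive multiple of the convex |w|^p. Direction (1, -1) follows by reflecting
    y. *)
Lemma burkholder_zigzag x y d e : `|d| = `|e| ->
  burkholder (x + d) (y + e) + burkholder (x - d) (y - e) <= 2 * burkholder x y.
Proof.
have diag u v s : burkholder (u + s) (v + s) + burkholder (u - s) (v - s) <= 2 * burkholder u v.
  have [uv|vu|->] := ltgtP u v.
  - by apply: (@burkholder_diag (v - u)) => //; lra.
  - have uv0 : 0 < u - v by lra.
    have uvE : - v - - u = u - v by ring.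
    have := burkholder_diag uv0 (- s) uvE.
    have E z : - z + - s = - (z + s) by ring.
    have F z : - z - - s = - (z - s) by ring.
    by rewrite !E !F !burkholderN.
  - have E w : burkholder w w = 2 `^ (p - 1) * (1 - b) * `|w| `^ p.
      have p1 : 0 < p by move/andP: hp => [? ?]; lra.
      rewrite /burkholder (_ : `|w| + `|w| = 2 * `|w|); last by ring.
      by rewrite powRM// -(mulr_powRB1 (normr_ge0 w) p1); ring.
    rewrite !E; have := norm_powR_midpoint v s.
    have := powR_gt0 (p - 1) (ltr0n R 2).
    set a2 := _ `^ (p - 1) => a20 H.
    have ab : 0 <= a2 * (b - 1) by have b1 := gt1_b; rewrite mulr_ge0; lra.
    have := ler_wpM2l ab H; lra.
move=> /eqP; rewrite eqr_norm2 => /orP[/eqP->|/eqP->]; first exact: diag.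
have := diag x (- y) (- e).
have E1 : - y - e = - (y + e) by ring.
have E2 : - y - - e = - (y - e) by ring.
by rewrite E1 E2 !burkholderNr.
Qed.

End Burkholder.

(** * Dyadic averages *)

Section Dyadic.
Context {R : realType}.
Local Notation mu := (@lebesgue_measure R).
Implicit Types (F G Y : R -> R) (n k : nat).

Definition dyadic_average F n k : R := 2 ^+ n * \int[mu]_(x in dyadic_interval n k) F x.

Lemma dyadic_intervalP n k (x : R) :
  dyadic_interval n k x <-> k%:R <= 2 ^+ n * x < k.+1%:R.
Proof.
rewrite /dyadic_interval /= in_itv/=.
by rewrite ler_pdivrMr ?exprn_gt0// ltr_pdivlMr ?exprn_gt0// mulrC.
Qed.

Lemma dyadic_interval_inj n k l (x : R) :
  dyadic_interval n k x -> dyadic_interval n l x -> k = l.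
Proof.
move=> /dyadic_intervalP/andP[k1 k2] /dyadic_intervalP/andP[l1 l2].
have := le_lt_trans k1 l2; have := le_lt_trans l1 k2.
by rewrite !ltr_nat !ltnS => lk kl; apply/eqP; rewrite eqn_leq lk kl.
Qed.

Lemma dyadic_interval_sub01 n k : (k < 2 ^ n)%N ->
  @dyadic_interval R n k `<=` `[0, 1].
Proof.
move=> kn x /dyadic_intervalP/andP[k1 k2]; rewrite /= in_itv/=.
have n0 : 0 < 2 ^+ n :> R by rewrite exprn_gt0.
rewrite -(pmulr_rge0 _ n0) (le_trans _ k1)//=.
rewrite -(ler_pM2l n0) mulr1 ltW// (lt_le_trans k2)//.
by rewrite -natrX ler_nat.
Qed.

Lemma measurable_dyadic n k : measurable (@dyadic_interval R n k).
Proof. exact: measurable_itv. Qed.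

Lemma mu_dyadic n k : mu (dyadic_interval n k) = (2 ^- n)%:E.
Proof.
rewrite lebesgue_measure_itv/= lte_fin ltr_pM2r ?invr_gt0 ?exprn_gt0//.
rewrite ltr_nat ltnSn -EFinB -mulrBl -natr1.
by rewrite (addrC k%:R) addrK mul1r.
Qed.

(** Subsets with this alternative form a sigma-algebra, and the disjointness of intervals of one
    generation puts the generators in it. *)
Lemma dyadic_sigma_atom n (A : set R) k : dyadic_sigma n A -> (k < 2 ^ n)%N ->
  dyadic_interval n k `<=` A \/ dyadic_interval n k `&` A = set0.
Proof.
move=> /(_ [set B | dyadic_interval n k `<=` B \/ dyadic_interval n k `&` B = set0]) + kn.
apply; split; first split.
- by right; rewrite setI0.
- move=> B [kB|kB].
    right; rewrite -subset0 => x [/kB Bx []] //.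
  left => x kx; split; first exact: dyadic_interval_sub01 kx.
  by move=> Bx; move: kB; rewrite -subset0 => /(_ x); apply.
- move=> B BP; have [[i ki]|nB] := pselect (exists i, dyadic_interval n k `<=` B i).
    by left => x /ki Bx; exists i.
  right; rewrite -subset0 => x [kx [i _ Bix]].
  have [ki|] := BP i; first by apply: nB; exists i.
  by rewrite -subset0 => /(_ x); apply.
- move=> B [l ln <-]; have [<-|kl] := eqVneq k l; first by left.
  right; rewrite -subset0 => x [kx lx].
  by move/eqP: kl; apply; exact: dyadic_interval_inj kx lx.
Qed.

(** This holds at every point of the interval, not only almost everywhere: the preimage of the
    single value [Y x] belongs to the sigma-algebra and meets the atom, hence contains it. *)
Lemma cond_expect_dyadic n F Y k x : is_cond_expect (dyadic_sigma n) F Y ->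
  (k < 2 ^ n)%N -> dyadic_interval n k x -> Y x = dyadic_average F n k.
Proof.
move=> [mY _ YF] kn kx.
have Yc y : dyadic_interval n k y -> Y y = Y x.
  move=> ky; have := mY [set Y x] (measurable_set1 _).
  move=> /dyadic_sigma_atom/(_ kn)[/(_ y ky)[_ //]|].
  rewrite -subset0 => /(_ x); case; split => //; split => //.
  exact: dyadic_interval_sub01 kx.
rewrite /dyadic_average -YF; last first.
  by apply: sub_sigma_algebra; exists k.
rewrite (@eq_Rintegral _ _ _ _ _ (cst (Y x))); last first.
  by move=> y; rewrite inE => /Yc.
rewrite Rintegral_cst; last exact: measurable_dyadic.
by rewrite [X in fine X]mu_dyadic/= mulrC -mulrA mulVf ?mulr1// expf_neq0.
Qed.

Lemma integrable_dyadic F n k : integrable01 F -> (k < 2 ^ n)%N ->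
  mu.-integrable (dyadic_interval n k) (EFin \o F).
Proof.
move=> iF kn; apply: integrableS iF => //; first exact: measurable_dyadic.
exact: dyadic_interval_sub01.
Qed.

Lemma dyadic_interval_split n k :
  @dyadic_interval R n k =
  dyadic_interval n.+1 k.*2 `|` dyadic_interval n.+1 k.*2.+1.
Proof.
have E1 : k.*2%:R = 2 * k%:R :> R by rewrite -muln2 natrM mulrC.
have E2 : k.*2.+1%:R = 2 * k%:R + 1 :> R by rewrite -natr1 E1.
have E3 : k.*2.+2%:R = 2 * k%:R + 2 :> R by rewrite -addn2 natrD E1.
have E4 : k.+1%:R = k%:R + 1 :> R by rewrite natr1.
apply/seteqP; split => x.
  move=> /dyadic_intervalP/andP[]; rewrite E4 => k1 k2.
  have [h|h] := ltP (2 ^+ n.+1 * x) (k.*2.+1%:R); [left|right];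
    apply/dyadic_intervalP; move: h; rewrite exprS ?E3 ?E2 ?E1 -mulrA; lra.
move=> [] /dyadic_intervalP; rewrite exprS ?E3 ?E2 ?E1 -mulrA => h;
  apply/dyadic_intervalP; rewrite E4; lra.
Qed.

Lemma dyadic_average_split F n k : integrable01 F -> (k < 2 ^ n)%N ->
  dyadic_average F n k =
  (dyadic_average F n.+1 k.*2 + dyadic_average F n.+1 k.*2.+1) / 2.
Proof.
move=> iF kn; rewrite /dyadic_average {1}dyadic_interval_split Rintegral_setU.
- by rewrite exprS; field.
- exact: measurable_dyadic.
- exact: measurable_dyadic.
- by rewrite -dyadic_interval_split; exact: integrable_dyadic.
apply/disj_setPRL => x kx kx'; have := dyadic_interval_inj kx kx'.
by move/eqP; rewrite (gtn_eqF (ltnSn _)).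
Qed.

(** The almost everywhere equality becomes an equality of numbers, since the left half has positive
    measure and so contains a point outside the exceptional set. On the right half the increments
    are the opposite ones. *)
Lemma transform_increments F G n k : integrable01 F -> integrable01 G ->
  martingale_transform F G -> (k < 2 ^ n)%N ->
  `|dyadic_average G n.+1 k.*2 - dyadic_average G n k| =
  `|dyadic_average F n.+1 k.*2 - dyadic_average F n k|.
Proof.
move=> iF iG [Fn [Gn [hF hG hFG]]] kn.
have kn' : (k.*2 < 2 ^ n.+1)%N by rewrite expnS mul2n ltn_double.
have [N [mN N0 sN]] := hFG n.
have [x [kx Nx]] : exists x, dyadic_interval n.+1 k.*2 x /\ ~ N x.
  apply: contrapT => /forallNP H.
  have : (mu (dyadic_interval n.+1 k.*2) <= mu N)%E.
    apply: le_measure; rewrite ?inE//; first exact: measurable_dyadic.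
    by move=> x kx; apply: contrapT => Nx; apply: (H x).
  by rewrite N0 mu_dyadic lee_fin leNgt invr_gt0 exprn_gt0.
have kx0 : dyadic_interval n k x by rewrite dyadic_interval_split; left.
have x01 : x \in `[0, 1] by have := dyadic_interval_sub01 kn' kx.
have := @contrapT _ (fun h => Nx (sN x h)) => /= /(_ x01).
rewrite (cond_expect_dyadic (hG n) kn kx0) (cond_expect_dyadic (hG n.+1) kn' kx).
by rewrite (cond_expect_dyadic (hF n) kn kx0) (cond_expect_dyadic (hF n.+1) kn' kx).
Qed.

Lemma sum_double (V : nmodType) (W : nat -> V) m :
  \sum_(0 <= k < m.*2) W k = \sum_(0 <= k < m) (W k.*2 + W k.*2.+1).
Proof.
elim: m => [|m IH]; first by rewrite !big_nil.
by rewrite doubleS !big_nat_recr//= IH addrA.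
Qed.

(** The halves of an interval with averages (x, y) have averages (x + d, y + e) and (x - d, y - e)
    with |d| = |e|, so the induction step is one use of the midpoint inequality per interval. *)
Lemma dyadic_supermartingale (W : R -> R -> R) F G n :
  (forall x y d e, `|d| = `|e| -> W (x + d) (y + e) + W (x - d) (y - e) <= 2 * W x y) ->
  integrable01 F -> integrable01 G -> martingale_transform F G ->
  \sum_(0 <= k < 2 ^ n) W (dyadic_average F n k) (dyadic_average G n k) <=
  2 ^+ n * W (expect F) (expect G).
Proof.
move=> hW iF iG hFG; elim: n => [|n IH].
  rewrite big_nat1 expr0 mul1r le_eqVlt; apply/orP; left; apply/eqP.
  have E H : integrable01 H -> dyadic_average H 0 0 = expect H.
    move=> iH; rewrite /dyadic_average /expect /dyadic_interval expr0 mul1r !divr1.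
    rewrite Rintegral_itv_bndo_bndc//.
    apply: integrableS iH => //; exact: subset_itv_co_cc.
  by rewrite !E.
rewrite expnS mul2n sum_double exprS -mulrA.
apply: le_trans (ler_wpM2l _ IH) => //.
rewrite mulr_sumr !big_mkord; apply: ler_sum => k _.
have := transform_increments iF iG hFG (ltn_ord k).
have sF := dyadic_average_split iF (ltn_ord k).
have sG := dyadic_average_split iG (ltn_ord k).
move: sF sG.
set x := dyadic_average F n k; set y := dyadic_average G n k.
set x1 := dyadic_average F _ _; set y1 := dyadic_average G _ _.
set x2 := dyadic_average F _ _; set y2 := dyadic_average G _ _.
move=> sF sG H; have := @hW x y (x1 - x) (y1 - y) (esym H).
have -> : x + (x1 - x) = x1 by ring.
have -> : y + (y1 - y) = y1 by ring.
have -> : x - (x1 - x) = x2 by lra.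
by have -> : y - (y1 - y) = y2 by lra.
Qed.

End Dyadic.

(** * From a majorant to the martingale inequality *)

Section TransformBound.
Context {R : realType}.
Local Notation mu := (@lebesgue_measure R).
Implicit Types (F G Y : R -> R) (n k : nat).

Lemma exists_dyadic_interval n (x : R) : 0 <= x < 1 ->
  exists2 k, (k < 2 ^ n)%N & dyadic_interval n k x.
Proof.
move=> /andP[x0 x1]; have n0 : 0 < 2 ^+ n :> R by rewrite exprn_gt0.
have /truncn_itv/andP[h1 h2] : 0 <= 2 ^+ n * x by rewrite mulr_ge0// ltW.
exists (Num.truncn (2 ^+ n * x)); last by apply/dyadic_intervalP; rewrite h1.
rewrite -(ltr_nat R) natrX (le_lt_trans h1)//.
by rewrite -[ltRHS]mulr1 ltr_pM2l.
Qed.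

Lemma ge0_integral_dyadic n (h : R -> \bar R) :
  measurable_fun (`[0, 1] : set R) h -> (forall x, 0 <= h x)%E ->
  (\int[mu]_(x in `[0%R, 1%R]) h x =
   \sum_(0 <= k < 2 ^ n) \int[mu]_(x in dyadic_interval n k) h x)%E.
Proof.
move=> mh h0; elim: n => [|n ->].
  rewrite big_nat1 /dyadic_interval expr0 !divr1 integral_itv_bndo_bndc//.
  by apply: measurable_funS mh => //; exact: subset_itv_co_cc.
rewrite expnS mul2n sum_double !big_mkord; apply: eq_bigr => k _.
rewrite dyadic_interval_split ge0_integral_setU//.
- exact: measurable_dyadic.
- exact: measurable_dyadic.
- rewrite -dyadic_interval_split; apply: measurable_funS mh => //.
  exact: dyadic_interval_sub01.
apply/disj_setPRL => x kx kx'; have := dyadic_interval_inj kx kx'.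
by move/eqP; rewrite (gtn_eqF (ltnSn _)).
Qed.

(** Jensen's inequality, by integrating the supporting line at the average. If the right-hand side
    is infinite there is nothing to prove; otherwise |F|^p is integrable and the two integrals can
    be compared. *)
Lemma dyadic_average_powR (p : R) F n k : 1 < p -> integrable01 F -> (k < 2 ^ n)%N ->
  ((2 ^- n * `|dyadic_average F n k| `^ p)%:E <=
   \int[mu]_(x in dyadic_interval n k) (`|F x| `^ p)%:E)%E.
Proof.
move=> p1 iF kn; set m := dyadic_average F n k.
have [l hl] := powR_tangent m p1.
have iFk := integrable_dyadic iF kn.
have mk := @measurable_dyadic R n k.
have icst (r : R) : mu.-integrable (dyadic_interval n k) (EFin \o cst r).
  apply/integrableP; split; first by apply/measurable_EFinP; exact: measurable_cst.
  rewrite (@eq_integral _ _ _ _ _ (cst `|r|%:E))// integral_cst// -/mu.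
  by rewrite [X in (_ * X)%E]mu_dyadic -EFinM ltry.
have iFm : mu.-integrable (dyadic_interval n k) (EFin \o (fun x => F x - m)).
  exact: (@integrableB _ _ _ mu _ mk _ _ iFk (icst m)).
have ilm : mu.-integrable (dyadic_interval n k) (EFin \o (fun x => l * (F x - m))).
  exact: (@integrableZl _ _ _ mu _ mk _ _ iFm).
have iL : mu.-integrable (dyadic_interval n k)
    (EFin \o (fun x => `|m| `^ p + l * (F x - m))).
  exact: (@integrableD _ _ _ mu _ mk _ _ (icst (`|m| `^ p)) ilm).
have E : \int[mu]_(x in dyadic_interval n k) (`|m| `^ p + l * (F x - m)) =
    2 ^- n * `|m| `^ p.
  rewrite (@RintegralD _ _ _ mu _ (cst (`|m| `^ p)) _ mk (icst _) ilm).
  rewrite (@RintegralZl _ _ _ mu _ _ _ mk iFm) (@RintegralB _ _ _ mu _ _ (cst m) mk iFk (icst m)).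
  rewrite !Rintegral_cst// -/mu ![X in fine X]mu_dyadic/= /m /dyadic_average.
  rewrite [X in l * X](_ : _ = 0) ?mulr0 ?addr0 1?mulrC//.
  by rewrite mulrA mulVf ?mul1r ?subrr// expf_neq0.
rewrite -E /Rintegral fineK; last exact: integrable_fin_num.
have mF : measurable_fun (dyadic_interval n k) F.
  by move/integrableP : iFk => [/measurable_EFinP].
have mFp : measurable_fun (dyadic_interval n k) (fun x => (`|F x| `^ p)%:E).
  apply/measurable_EFinP; apply: (measurableT_comp (measurable_powR _)).
  exact: measurableT_comp.
have [fin|] := ltP (\int[mu]_(x in dyadic_interval n k) (`|F x| `^ p)%:E)%E +oo%E; last first.
  by rewrite leye_eq => /eqP ->; exact: leey.
apply: le_integral => //.
  apply/integrableP; split => //.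
  apply: le_lt_trans fin; apply: ge0_le_integral => //.
  - by apply: measurableT_comp.
  - by move=> x _; rewrite /= ger0_norm ?powR_ge0.
by move=> x _; rewrite lee_fin.
Qed.

Lemma expect_dyadic_average (p : R) F n : 1 < p -> integrable01 F ->
  ((2 ^- n * \sum_(0 <= k < 2 ^ n) `|dyadic_average F n k| `^ p)%:E <=
   nnexpect (fun x => (`|F x| `^ p)%R))%E.
Proof.
move=> p1 iF; have mF : measurable_fun (`[0, 1] : set R) F.
  by move/integrableP : iF => [/measurable_EFinP].
rewrite /nnexpect (@ge0_integral_dyadic n); last 2 first.
- apply/measurable_EFinP; apply: (measurableT_comp (measurable_powR _)).
  exact: measurableT_comp.
- by move=> x; rewrite lee_fin powR_ge0.
rewrite mulr_sumr -sumEFin !big_mkord; apply: lee_sum => k _.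
exact: dyadic_average_powR.
Qed.

Lemma nnexpect_dyadic (W : R -> R -> R) F G (Fn Gn : R -> R) n :
  is_cond_expect (dyadic_sigma n) F Fn -> is_cond_expect (dyadic_sigma n) G Gn ->
  (forall x y, 0 <= W x y) ->
  measurable_fun (`[0, 1] : set R) (fun x => W (Fn x) (Gn x)) ->
  nnexpect (fun x => W (Fn x) (Gn x)) =
  (2 ^- n * \sum_(0 <= k < 2 ^ n) W (dyadic_average F n k) (dyadic_average G n k))%:E.
Proof.
move=> hF hG W0 mW; rewrite /nnexpect (@ge0_integral_dyadic n); last 2 first.
- exact/measurable_EFinP.
- by move=> x; rewrite lee_fin.
rewrite mulr_sumr -sumEFin !big_mkord; apply: eq_bigr => k _.
rewrite (@eq_integral _ _ _ _ _
  (cst (W (dyadic_average F n k) (dyadic_average G n k))%:E)); last first.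
  move=> x; rewrite inE => kx.
  by rewrite (cond_expect_dyadic hF _ kx)// (cond_expect_dyadic hG _ kx).
rewrite (@integral_cst _ _ _ mu _ (@measurable_dyadic R n k)) [X in (_ * X)%E]mu_dyadic.
by rewrite -EFinM mulrC.
Qed.

(** Differentiation along shrinking sets asks for a family at every real x, hence the floor; for x
    in [0, 1[ this is the dyadic interval of generation n containing x. *)
Definition dyadic_nbh (x : R) n : set R :=
  `[(Num.floor (2 ^+ n * x))%:~R / 2 ^+ n, (Num.floor (2 ^+ n * x) + 1)%:~R / 2 ^+ n[.

Lemma mu_dyadic_nbh x n : mu (dyadic_nbh x n) = (2 ^- n)%:E.
Proof.
rewrite lebesgue_measure_itv/= lte_fin ltr_pM2r ?invr_gt0 ?exprn_gt0//.
rewrite ltr_int ltrDl ltr01 -EFinB -mulrBl intrD.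
by rewrite addrAC subrr add0r mul1r.
Qed.

Lemma dyadic_nbh_nicely x : nicely_shrinking x (dyadic_nbh x).
Proof.
split; first by move=> n; exact: measurable_itv.
have pos n : 0 < 2 * 2 ^- n :> R by rewrite mulr_gt0// invr_gt0 exprn_gt0.
(* A ball of radius 2 * 2^-n has measure 4 * 2^-n, four times that of the interval. *)
exists (4, fun n => PosNum (pos n)); split => //=.
- rewrite -[X in _ --> X](mulr0 2); apply: cvgM; first exact: cvg_cst.
  under eq_fun do rewrite -exprVn.
  by apply: cvg_expr; rewrite ger0_norm; lra.
- move=> n y; rewrite /dyadic_nbh /ball/= in_itv/=.
  have n0 : 0 < 2 ^+ n :> R by rewrite exprn_gt0.
  rewrite ler_pdivrMr// ltr_pdivlMr// => /andP[h1 h2].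
  have /andP[h3 h4] := floor_itv (2 ^+ n * x).
  rewrite intrD in h2 h4.
  rewrite -(ltr_pM2l n0) mulrCA mulfV ?gt_eqF// mulr1.
  rewrite -(gtr0_norm n0) -normrM ltr_norml mulrBr; lra.
move=> n; rewrite lebesgue_measure_ball ?mu_dyadic_nbh -?EFinM ?lee_fin; last exact: ltW.
rewrite -mulr_natl; lra.
Qed.

(** The value [Fn n x] is the average of F over the dyadic interval around x, so this is Lebesgue
    differentiation; F is extended by 0 to be locally integrable on the line. *)
Lemma cond_expect_cvg F (Fn : nat -> R -> R) : integrable01 F ->
  (forall n, is_cond_expect (dyadic_sigma n) F (Fn n)) ->
  {ae mu, forall x, x \in `[0, 1[ -> Fn n x @[n --> \oo] --> F x}.
Proof.
move=> iF hF; pose f := F \_ `[0, 1].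
have locf : locally_integrable setT f.
  apply: open_integrable_locally; first exact: openT.
  rewrite /f -restrict_EFin.
  by apply/(integrable_mkcond _ _).1.
have := lebesgue_differentiation locf.
apply: (@filterS _ _ (ae_filter_ringOfSetsType mu)) => x lx.
rewrite in_itv/= => x01.
have := nice_lebesgue_differentiation dyadic_nbh_nicely locf lx.
have fx : f x = F x.
  rewrite /f patchE mem_set//= in_itv/=; case/andP: x01 => -> /ltW ->//.
rewrite fx => /fine_cvgP[_]; apply: cvg_trans; apply: near_eq_cvg; near=> n.
have [k kn kx] := exists_dyadic_interval n x01.
have E : dyadic_nbh x n = dyadic_interval n k.
  have k1 : (k%:Z + 1)%:~R = k.+1%:R :> R by rewrite -PoszD addn1.
  have fl : Num.floor (2 ^+ n * x) = k by apply: floor_def; rewrite k1; apply/dyadic_intervalP.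
  by rewrite /dyadic_nbh fl k1.
rewrite /= mu_dyadic_nbh E (cond_expect_dyadic (hF n) kn kx) /dyadic_average.
have -> : (((2 ^- n)%:E)^-1 = (2 ^+ n)%:E :> \bar R)%E.
  by rewrite inver invr_eq0 expf_eq0 pnatr_eq0 andbF invrK.
have iFk := integrable_dyadic iF kn.
have -> : (\int[mu]_(y in dyadic_interval n k) (f y)%:E =
         \int[mu]_(y in dyadic_interval n k) (F y)%:E)%E.
  apply: eq_integral => y /[!inE] ky; rewrite /= /f patchE mem_set//.
  exact: dyadic_interval_sub01 ky.
rewrite fineM//; exact: (@integrable_fin_num _ _ _ mu _ (@measurable_dyadic R n k)).
Unshelve. all: by end_near. Qed.

Lemma transform_bound_majorant (p tau beta K A : R) b :
  1 < p < 2 -> 1 <= b * (p - 1) -> beta <= b -> 0 < K -> 0 <= A ->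
  (forall x y, (tau ^+ 2 * x ^+ 2 + y ^+ 2) `^ (p / 2) - K * `|x| `^ p <=
     A * burkholder p b x y) ->
  transform_bound p tau beta K.
Proof.
move=> hp hb betab K0 A0 maj F G iF iG hFG bnd.
have [p1 p2] := andP hp.
pose W (x y : R) := (tau ^+ 2 * x ^+ 2 + y ^+ 2) `^ (p / 2).
have W0 x y : 0 <= W x y by exact: powR_ge0.
have zz x y d e : `|d| = `|e| -> burkholder p b (x + d) (y + e) +
    burkholder p b (x - d) (y - e) <= 2 * burkholder p b x y.
  exact: burkholder_zigzag.
(* The starting point satisfies |y| <= b |x|, the region where Burkholder's function is
   nonpositive. *)
have b0 : burkholder p b (expect F) (expect G) <= 0.
  rewrite /burkholder mulr_ge0_le0 ?powR_ge0// subr_le0.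
  by rewrite (le_trans bnd)// ler_wpM2r.
have [Fn [Gn [hF hG _]]] := hFG.
have mW (X Y : R -> R) : measurable_fun (`[0, 1] : set R) X ->
    measurable_fun (`[0, 1] : set R) Y ->
    measurable_fun (`[0, 1] : set R) (fun x => W (X x) (Y x)).
  move=> mX mY; apply: (measurableT_comp (measurable_powR _)).
  apply: measurable_funD; last exact: measurable_funX.
  by apply: measurable_funM => //; exact: measurable_funX.
have mI (X : R -> R) : integrable01 X -> measurable_fun (`[0, 1] : set R) X.
  by move=> /integrableP[/measurable_EFinP].
have mFn n : measurable_fun (`[0, 1] : set R) (Fn n) by have [_ /mI] := hF n.
have mGn n : measurable_fun (`[0, 1] : set R) (Gn n) by have [_ /mI] := hG n.
have step n : (nnexpect (fun x => W (Fn n x) (Gn n x)) <=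
    K%:E * nnexpect (fun x => (`|F x| `^ p)%R))%E.
  rewrite (nnexpect_dyadic (hF n) (hG n))//; last exact: mW.
  apply: (@le_trans _ _ (K%:E *
    (2 ^- n * \sum_(0 <= k < 2 ^ n) `|dyadic_average F n k| `^ p)%:E)%E); last first.
    by rewrite lee_pmul2l ?lte_fin//; exact: expect_dyadic_average.
  rewrite -EFinM lee_fin mulrCA ler_wpM2l ?invr_ge0 ?exprn_ge0//.
  rewrite -subr_le0 mulr_sumr -sumrB.
  apply: (@le_trans _ _ (A * \sum_(0 <= k < 2 ^ n)
    burkholder p b (dyadic_average F n k) (dyadic_average G n k))).
    by rewrite mulr_sumr; apply: ler_sum => k _; exact: maj.
  rewrite mulr_ge0_le0// (le_trans (dyadic_supermartingale n zz iF iG hFG))//.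
  by rewrite mulr_ge0_le0.
have m01 : measurable (`[0, 1[ : set R) by exact: measurable_itv.
have sub01 : (`[0, 1[ : set R) `<=` `[0, 1] by exact: subset_itv_co_cc.
have mWn n : measurable_fun (`[0, 1[ : set R) (fun x => (W (Fn n x) (Gn n x))%:E).
  by apply: measurable_funS sub01 _ => //; apply/measurable_EFinP; exact: mW.
have W01 (X Y : R -> R) : measurable_fun (`[0, 1] : set R) X ->
    measurable_fun (`[0, 1] : set R) Y ->
    nnexpect (fun x => W (X x) (Y x)) = (\int[mu]_(x in `[0%R, 1%R[) (W (X x) (Y x))%:E)%E.
  move=> mX mY; rewrite /nnexpect integral_itv_bndo_bndc//.
  by apply: measurable_funS sub01 _ => //; apply/measurable_EFinP; exact: mW.
(* The bound holds for each n, hence for the lower limit; Fatou's lemma then reduces the claim to a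
   pointwise comparison with the lower limit of [W (Fn n x) (Gn n x)]. *)
apply: (@le_trans _ _ (limn_einf (fun n => nnexpect (fun x => W (Fn n x) (Gn n x))))); last first.
  rewrite limn_einf_lim; apply: lime_le; first exact: is_cvg_einfs.
  apply: nearW => n; apply: le_trans (step n).
  by apply: ereal_inf_lbound; exists n => //=.
have -> : (fun n => nnexpect (fun x => W (Fn n x) (Gn n x))) =
    (fun n => \int[mu]_(x in `[0%R, 1%R[) (W (Fn n x) (Gn n x))%:E)%E.
  by apply/funext => n; exact: W01.
apply: le_trans (@fatou _ _ _ mu _ m01 (fun n x => (W (Fn n x) (Gn n x))%:E) mWn _); last first.
  by move=> n x _; rewrite lee_fin.
rewrite -/(W _ _) W01; [|exact: mI..].
have einf0 (X Y : nat -> R -> R) x :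
    (0 <= limn_einf (fun n => (W (X n x) (Y n x))%:E))%E.
  rewrite limn_einf_lim; apply: lime_ge; first exact: is_cvg_einfs.
  by apply: nearW => n; apply: le_ereal_inf_tmp => _ [m _ <-]; rewrite lee_fin.
apply: (@ae_ge0_le_integral _ _ _ mu _ m01).
- by move=> x _; rewrite lee_fin.
- by apply: measurable_funS sub01 _ => //; apply/measurable_EFinP; apply: mW; exact: mI.
- by move=> x _; exact: einf0.
- rewrite /limn_einf; apply: measurableT_comp => //.
  apply: measurable_fun_limn_esup => n; apply: measurableT_comp => //.
  exact: mWn.
have cvF := cond_expect_cvg iF hF; have cvG := cond_expect_cvg iG hG.
move: cvF; apply: filter_app; first exact: (ae_filter_ringOfSetsType mu).
move: cvG; apply: filterS; first exact: (ae_filter_ringOfSetsType mu).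
move=> x cG cF x01; have {}cF := cF x01; have {}cG := cG x01.
(* Continuity of the power is derived from its differentiability at positive arguments; at argument
   0 the left-hand side is 0. *)
have [S0|S0] := eqVneq (tau ^+ 2 * F x ^+ 2 + G x ^+ 2) 0.
  by rewrite /W S0 powR0; [exact: einf0|lra].
have Sgt : 0 < tau ^+ 2 * F x ^+ 2 + G x ^+ 2.
  rewrite lt_neqAle eq_sym S0 andTb.
  by apply: addr_ge0; [apply: mulr_ge0|]; exact: sqr_ge0.
suff cW : (fun n => (W (Fn n x) (Gn n x))%:E) @ \oo --> (W (F x) (G x))%:E.
  by have [-> _] := cvg_limn_einf_sup cW; exact: lexx.
apply: cvg_EFin; first exact: nearW.
apply: (@continuous_cvg _ _ _ _ _ (fun n => tau ^+ 2 * Fn n x ^+ 2 + Gn n x ^+ 2)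
  (fun y => y `^ (p / 2))).
  have [h _] := is_derive1_powR (p / 2) Sgt.
  exact/differentiable_continuous/derivable1_diffP.
by apply: cvgD; [apply: cvgM; [exact: cvg_cst|]|]; apply: cvgM.
Qed.

End TransformBound.

(** * The curve (t, g t, f t) *)

Section Curve.
Context {R : realType}.
Variables (p tau : R).
Hypothesis hp : 1 < p < 2.
Implicit Types (t y z K A : R).

Local Notation T := (tau ^+ 2).
Local Notation f := (f p tau).
Local Notation g := (g p).

Definition radius2 t : R := (1 + t) ^+ 2 + T * (1 - t) ^+ 2.
Definition f1 t : R := p * (1 + t - T * (1 - t)) * radius2 t `^ (p / 2 - 1).
Definition f2 t : R :=
  p * radius2 t `^ (p / 2 - 2) * ((p - 1) * (1 + T) * radius2 t + 4 * (2 - p) * T).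
Definition g1 t : R := - p * (1 - t) `^ (p - 1).
Definition g2 t : R := p * (p - 1) * (1 - t) `^ (p - 2).

(* The ratio y/x at the point (x, y) = (1 - t, 1 + t). *)
Definition ratio t : R := (1 + t) / (1 - t).
(** In terms of the ratio, [phi] is f / g and [rho] is f'' / g''. Thus K >= [phi] means that f - K g
    is nonpositive at the point, and K >= [rho] on an interval that f - K g is concave there. *)
Definition phi y : R := (T + y ^+ 2) `^ (p / 2).
Definition rho y : R :=
  (T + 1) * (T + y ^+ 2) `^ (p / 2 - 1) +
  (2 - p) / (p - 1) * T * (1 + y) ^+ 2 * (T + y ^+ 2) `^ (p / 2 - 2).

Lemma radius2_gt0 t : -1 < t -> 0 < radius2 t.
Proof.
move=> t1; apply: ltr_wpDr; first by rewrite mulr_ge0 ?sqr_ge0.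
by apply: exprn_gt0; lra.
Qed.

Lemma radius2_gt0T t : 0 < T -> 0 < radius2 t.
Proof.
move=> T0; have [t1|t1] := ltP t 1; last first.
  by apply: radius2_gt0; apply: lt_le_trans t1; lra.
rewrite /radius2 ltr_wpDl ?sqr_ge0//; apply: mulr_gt0 => //.
by apply: exprn_gt0; lra.
Qed.

Lemma g_gt0 t : t < 1 -> 0 < g t.
Proof. by move=> t1; rewrite /Defs.g powR_gt0// subr_gt0. Qed.

Lemma g2_gt0 t : t < 1 -> 0 < g2 t.
Proof.
have [p1 p2] := andP hp.
by move=> t1; rewrite /g2 !mulr_gt0 ?powR_gt0//; lra.
Qed.

Lemma is_derive_g t : t < 1 -> is_derive t 1 g (g1 t).
Proof.
move=> t1; rewrite /Defs.g /g1.
have H : is_derive t 1 (fun t : R => 1 - t) (- 1).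
  by apply: is_derive_eq; rewrite add0r mul1r.
have t10 : 0 < 1 - t by lra.
apply: (is_derive_eq (is_derive_powR_comp p H t10)); ring.
Qed.

Lemma is_derive_g1 t : t < 1 -> is_derive t 1 g1 (g2 t).
Proof.
move=> t1; rewrite /g1 /g2.
have H : is_derive t 1 (fun t : R => 1 - t) (- 1).
  by apply: is_derive_eq; rewrite add0r mul1r.
have t10 : 0 < 1 - t by lra.
have H2 := is_derive_powR_comp (p - 1) H t10.
apply: is_derive_eq; rewrite /GRing.scale/=.
by rewrite (_ : p - 1 - 1 = p - 2); ring.
Qed.

Lemma is_derive_radius2 t : is_derive t 1 radius2 (2 * (1 + t - T * (1 - t))).
Proof.
rewrite /radius2; apply: is_derive_eq; rewrite /GRing.scale/=; ring.
Qed.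

Lemma is_derive_f t : 0 < radius2 t -> is_derive t 1 f (f1 t).
Proof.
move=> r0; rewrite /Defs.f /f1.
apply: (is_derive_eq (is_derive_powR_comp (p / 2) (is_derive_radius2 t) r0)).
by field.
Qed.

Lemma is_derive_f1 t : 0 < radius2 t -> is_derive t 1 f1 (f2 t).
Proof.
move=> r0; rewrite /f1 /f2.
have H := is_derive_powR_comp (p / 2 - 1) (is_derive_radius2 t) r0.
apply: is_derive_eq; rewrite /GRing.scale/=.
have -> : p / 2 - 1 - 1 = p / 2 - 2 by ring.
have -> : p / 2 - 1 = p / 2 - 2 + 1 by ring.
rewrite powRS//; set W := _ `^ (p / 2 - 2).
by rewrite /radius2; field.
Qed.

Lemma ratio_ge0 t : -1 <= t -> t < 1 -> 0 <= ratio t.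
Proof. by move=> t1 t2; rewrite /ratio divr_ge0//; lra. Qed.

Lemma ratio_gt0 t : -1 < t -> t < 1 -> 0 < ratio t.
Proof. by move=> t1 t2; rewrite /ratio divr_gt0//; lra. Qed.

Lemma ltr_ratio t1 t2 : t1 < t2 -> t2 < 1 -> ratio t1 < ratio t2.
Proof.
move=> t12 t21; rewrite /ratio ltr_pdivrMr; last lra.
rewrite mulrAC ltr_pdivlMr; last lra.
nra.
Qed.

Lemma radius2E t : t < 1 -> radius2 t = (1 - t) ^+ 2 * (T + ratio t ^+ 2).
Proof. by move=> t1; rewrite /radius2 /ratio; field; lra. Qed.

Lemma ratio_radius2 t : t < 1 -> 0 < radius2 t -> 0 < T + ratio t ^+ 2.
Proof.
move=> t1; rewrite radius2E// pmulr_rgt0// exprn_gt0//; lra.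
Qed.

Lemma powR_sqr (x a : R) : 0 <= x -> (x ^+ 2) `^ a = x `^ (2 * a).
Proof. by move=> x0; rewrite -(powR_mulrn 2 x0) -powRrM. Qed.

Lemma f_phi t : t < 1 -> f t = g t * phi (ratio t).
Proof.
move=> t1; rewrite /Defs.f -/(radius2 t) radius2E// powRM ?sqr_ge0//; last first.
  by rewrite addr_ge0 ?sqr_ge0.
rewrite powR_sqr; last lra.
by rewrite /Defs.g /phi; congr (_ `^ _ * _); field.
Qed.

Lemma f2_rho t : t < 1 -> 0 < radius2 t -> f2 t = g2 t * rho (ratio t).
Proof.
have [p1 p2] := andP hp.
move=> t1 r0; have Q0 := ratio_radius2 t1 r0; have t10 : 0 < 1 - t by lra.
rewrite /f2 /g2 /rho radius2E// powRM ?sqr_ge0 ?ltW// powR_sqr ?ltW//.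
have -> : p / 2 - 1 = p / 2 - 2 + 1 by ring.
rewrite [in RHS]powRS//.
have -> : p - 2 = 2 * (p / 2 - 2) + 1 + 1 by field.
rewrite !powRS//.
set W := _ `^ (2 * _); set V := _ `^ (p / 2 - 2).
rewrite /ratio; field; apply/andP; split; lra.
Qed.

(** Differentiating f = g * [phi (ratio t)] leaves the term g phi'(ratio) ratio', where ratio' = 2 /
    (1 - t)^2. *)
Lemma f1_phi t : t < 1 -> 0 < radius2 t ->
  f1 t - phi (ratio t) * g1 t =
  2 * (1 - t) `^ (p - 2) * (p * ratio t * (T + ratio t ^+ 2) `^ (p / 2 - 1)).
Proof.
move=> t1 r0; have Q0 := ratio_radius2 t1 r0; have t10 : 0 < 1 - t by lra.
rewrite /f1 /g1 /phi radius2E// powRM ?sqr_ge0 ?ltW// powR_sqr ?ltW//.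
have -> : p / 2 = p / 2 - 1 + 1 by ring.
rewrite [in LHS]powRS//.
have -> : p - 1 = p - 2 + 1 by ring.
have -> : 2 * (p / 2 - 1 + 1 - 1) = p - 2 by field.
have -> : p / 2 - 1 + 1 - 1 = p / 2 - 1 by ring.
rewrite !powRS//.
set W := _ `^ (p - 2); set V := _ `^ (p / 2 - 1).
rewrite /ratio; field; lra.
Qed.

Lemma ler_phi y1 y2 : 0 <= y1 -> y1 <= y2 -> phi y1 <= phi y2.
Proof.
have [p1 p2] := andP hp.
move=> y10 y12; rewrite /phi; apply: ge0_ler_powR;
  rewrite ?nnegrE ?addr_ge0 ?sqr_ge0//; first lra.
rewrite lerD2l; apply: lerXn2r => //; rewrite nnegrE//; exact: le_trans y12.
Qed.

Lemma phi_gt0 y : 0 < y -> 0 < phi y.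
Proof. by move=> y0; rewrite /phi powR_gt0// ltr_wpDl ?sqr_ge0// exprn_gt0. Qed.

Lemma g1_incr (x y : R) : x < y -> y < 1 -> g1 x < g1 y.
Proof.
have [p1 p2] := andP hp; move=> xy y1; rewrite /g1 !mulNr ltrN2 ltr_pM2l; last lra.
by apply: gt0_ltr_powR; rewrite ?nnegrE; lra.
Qed.

Lemma g_tangent_lt s t : s < 1 -> t < 1 -> s != t -> g s + g1 s * (t - s) < g t.
Proof.
have dg (x y : R) : y < 1 -> forall z, x <= z <= y -> is_derive z 1 g (g1 z).
  by move=> y1 z /andP[_ zy]; apply: is_derive_g; exact: le_lt_trans y1.
move=> s1 t1; rewrite neq_lt => /orP[st|ts].
  have [x /andP[sx xt] e] := mvt st (dg s t t1).
  have : 0 < (g1 x - g1 s) * (t - s).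
    by apply: mulr_gt0; rewrite subr_gt0//; apply: g1_incr => //; lra.
  by rewrite mulrBl -e; lra.
have [x /andP[tx xs] e] := mvt ts (dg t s s1).
have : 0 < (g1 s - g1 x) * (s - t).
  by apply: mulr_gt0; rewrite subr_gt0//; apply: g1_incr => //; lra.
by rewrite mulrBl -e; lra.
Qed.

Lemma g_tangent s t : s < 1 -> t < 1 -> g s + g1 s * (t - s) <= g t.
Proof.
move=> s1 t1; have [->|st] := eqVneq s t; first by rewrite subrr mulr0 addr0.
by apply: ltW; exact: g_tangent_lt.
Qed.

End Curve.

(** * Bitangent lines *)

Section Bitangent.
Context {R : realType}.
Variables (p tau : R).
Hypothesis hp : 1 < p < 2.
Implicit Types (t y z K A : R).

Local Notation T := (tau ^+ 2).
Local Notation f := (f p tau).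
Local Notation g := (g p).
Local Notation f1 := (f1 p tau).
Local Notation f2 := (f2 p tau).
Local Notation g1 := (g1 p).
Local Notation g2 := (g2 p).
Local Notation rho := (rho p tau).
Local Notation phi := (phi p tau).
Local Notation radius2 := (radius2 tau).

Lemma is_derive_gap K t : t < 1 -> 0 < radius2 t ->
  is_derive t 1 (fun t => f t - K * g t) (f1 t - K * g1 t).
Proof.
move=> t1 r0; have Hf := @is_derive_f R p tau t r0; have Hg := @is_derive_g R p t t1.
by apply: is_derive_eq; rewrite /GRing.scale/=; ring.
Qed.

Lemma is_derive_gap1 K t : t < 1 -> 0 < radius2 t ->
  is_derive t 1 (fun t => f1 t - K * g1 t) (g2 t * (rho (ratio t) - K)).
Proof.
move=> t1 r0; have Hf := @is_derive_f1 R p tau t r0; have Hg := @is_derive_g1 R p t t1.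
by apply: is_derive_eq; rewrite /GRing.scale/= (f2_rho hp)//; ring.
Qed.

(** * Unimodality of f'' / g'' and lines tangent at two points *)

Section Unimodal.
Hypothesis T0 : 0 < T.

Definition rho_cubic y : R :=
  - (T + 1) * y * (T + y ^+ 2) +
  T / (p - 1) * (1 + y) * (2 * T - (4 - p) * y - (2 - p) * y ^+ 2).

Lemma is_derive_rho y : is_derive y 1 rho
  ((2 - p) * (T + y ^+ 2) `^ (p / 2 - 3) * rho_cubic y).
Proof.
have [p1 p2] := andP hp.
have Q0 : 0 < T + y ^+ 2 by have := T0; rewrite ltr_wpDr ?sqr_ge0.
have HQ : is_derive y 1 (fun y => T + y ^+ 2) (2 * y).
  by apply: is_derive_eq; rewrite /GRing.scale/=; ring.
have H1 := is_derive_powR_comp (p / 2 - 1) HQ Q0.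
have H2 := is_derive_powR_comp (p / 2 - 2) HQ Q0.
rewrite /rho; apply: is_derive_eq; rewrite /GRing.scale/= /rho_cubic.
have -> : p / 2 - 1 - 1 = p / 2 - 3 + 1 by ring.
have -> : p / 2 - 2 - 1 = p / 2 - 3 by ring.
have -> : p / 2 - 2 = p / 2 - 3 + 1 by ring.
rewrite !powRS//; set W := _ `^ (p / 2 - 3).
by field; lra.
Qed.

(** The quotient [rho_cubic y / y] is strictly decreasing for y > 0, so the derivative of [rho] can
    change sign only once, from + to -. *)
Lemma rho_cubic_lt0 y1 y2 : 0 < y1 -> y1 < y2 -> rho_cubic y1 <= 0 -> rho_cubic y2 < 0.
Proof.
have [p1 p2] := andP hp; have Tp := T0.
move=> y10 y12 c1; have y20 := lt_trans y10 y12.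
rewrite -(pmulr_rlt0 _ y10); apply: lt_le_trans (_ : y2 * rho_cubic y1 <= 0); last first.
  by rewrite pmulr_rle0.
rewrite -subr_gt0.
pose q := (p - 1)^-1; have q0 : 0 < q by rewrite invr_gt0; lra.
have -> : y2 * rho_cubic y1 - y1 * rho_cubic y2 =
  (y2 - y1) * (2 * T ^+ 2 * q + y1 * y2 * (T * q * (4 - p + 2 - p) +
     (T + 1 + T * q * (2 - p)) * (y1 + y2))).
  by rewrite /rho_cubic /q; field; lra.
apply: mulr_gt0; first lra.
have Tq : 0 < T * q by rewrite mulr_gt0.
have Tqp : 0 <= T * q * (2 - p) by apply: mulr_ge0; lra.
have TTq : 0 < 2 * T ^+ 2 * q.
  by apply: mulr_gt0 => //; apply: mulr_gt0 => //; exact: exprn_gt0.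
apply: ltr_pwDl => //; apply: mulr_ge0; first by apply: mulr_ge0; lra.
apply: addr_ge0; first by apply: mulr_ge0; lra.
by apply: mulr_ge0; lra.
Qed.

Lemma rho_unimodal y1 y2 y3 : 0 <= y1 -> y1 < y2 -> y2 < y3 ->
  rho y2 <= rho y1 -> rho y3 < rho y2.
Proof.
have [p1 p2] := andP hp.
move=> y10 y12 y23 r12.
have W0 y : 0 < (2 - p) * (T + y ^+ 2) `^ (p / 2 - 3).
  have Tp := T0; apply: mulr_gt0; first lra.
  by apply: powR_gt0; rewrite ltr_wpDr ?sqr_ge0.
have [x1 /andP[x1l x1r] e1] := mvt y12 (fun y _ => is_derive_rho y).
have [x2 /andP[x2l x2r] e2] := mvt y23 (fun y _ => is_derive_rho y).
have c1 : rho_cubic x1 <= 0.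
  have : (2 - p) * (T + x1 ^+ 2) `^ (p / 2 - 3) * rho_cubic x1 * (y2 - y1) <= 0.
    by rewrite -e1 subr_le0.
  by rewrite pmulr_lle0 ?subr_gt0// pmulr_rle0.
have c2 : rho_cubic x2 < 0.
  by apply: rho_cubic_lt0 c1; [exact: le_lt_trans x1l|exact: lt_trans x2l].
by rewrite -subr_lt0 e2 pmulr_llt0 ?subr_gt0// pmulr_rlt0.
Qed.

Lemma rho_ratio_unimodal t1 t2 t3 : -1 <= t1 -> t1 < t2 -> t2 < t3 -> t3 < 1 ->
  rho (ratio t2) <= rho (ratio t1) -> rho (ratio t3) < rho (ratio t2).
Proof.
move=> t1m t12 t23 t31; apply: rho_unimodal.
- by apply: ratio_ge0 => //; lra.
- by apply: ltr_ratio => //; lra.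
- exact: ltr_ratio.
Qed.

Definition bitangent (a s K A : R) : Prop :=
  [/\ f1 a - K * g1 a = A, f1 s - K * g1 s = A &
      f s - K * g s - (f a - K * g a) = A * (s - a)].

(** The gap [D] to the line has double zeros at a and s, so Rolle's theorem gives two points between
    them where [rho] equals K. By unimodality [rho] is at most K to the left of the first and to the
    right of the second, and this settles t outside ]a, s[. *)
Lemma bitangent_dominates a s K A : -1 <= a -> a < s -> s < 1 -> bitangent a s K A ->
  [/\ forall t, -1 <= t < 1 -> f t - K * g t <= f s - K * g s + A * (t - s),
      forall t, s <= t < 1 -> rho (ratio t) <= K,
      rho (ratio a) <= K &
      exists2 t, a < t < s & rho (ratio t) = K].
Proof.
move=> a1 as_ s1 [Aa As VA].
have r0 t : 0 < radius2 t by exact: radius2_gt0T.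
pose D t := f t - K * g t - (f s - K * g s) - A * (t - s).
pose D1 t := f1 t - K * g1 t - A.
pose D2 t := g2 t * (rho (ratio t) - K).
have dD t : t < 1 -> is_derive t 1 D (D1 t).
  move=> t1; have H := is_derive_gap K t1 (r0 t).
  by rewrite /D /D1; apply: is_derive_eq; rewrite /GRing.scale/=; ring.
have dD1 t : t < 1 -> is_derive t 1 D1 (D2 t).
  move=> t1; have H := is_derive_gap1 K t1 (r0 t).
  by rewrite /D1 /D2; apply: is_derive_eq; ring.
have mvtD x y : x < y -> y < 1 -> exists2 z, x < z < y & D y - D x = D1 z * (y - x).
  by move=> xy y1; apply: mvt xy _ => z /andP[_ zy]; apply: dD; exact: le_lt_trans y1.
have mvtD1 x y : x < y -> y < 1 -> exists2 z, x < z < y & D1 y - D1 x = D2 z * (y - x).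
  by move=> xy y1; apply: mvt xy _ => z /andP[_ zy]; apply: dD1; exact: le_lt_trans y1.
have a_1 := lt_trans as_ s1.
have Ds : D s = 0 by rewrite /D; ring.
have Da : D a = 0.
  have E : A * (a - s) = - (A * (s - a)) by ring.
  by rewrite /D E -VA; ring.
have D1s : D1 s = 0 by rewrite /D1 As subrr.
have D1a : D1 a = 0 by rewrite /D1 Aa subrr.
have g20 t : t < 1 -> 0 < g2 t by exact: g2_gt0.
have D2_gt0 t : t < 1 -> (0 < D2 t) = (K < rho (ratio t)).
  by move=> t1; rewrite /D2 pmulr_rgt0 ?g20// subr_gt0.
have D2_lt0 t : t < 1 -> (D2 t < 0) = (rho (ratio t) < K).
  by move=> t1; rewrite /D2 pmulr_rlt0 ?g20// subr_lt0.
have [xi /andP[axi xis] exi] := mvtD _ _ as_ s1.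
have D1xi : D1 xi = 0.
  move: exi; rewrite Ds Da subrr => /esym/eqP; rewrite mulf_eq0 (subr_eq0 s) (gt_eqF as_) orbF.
  by move/eqP.
have root x y : x < y -> y < 1 -> D1 x = 0 -> D1 y = 0 ->
    exists2 al, x < al < y & rho (ratio al) = K.
  move=> xy y1 Dx Dy.
  have [al al1 eal] := mvtD1 _ _ xy y1.
  exists al => //; move: eal; rewrite Dx Dy subrr => /esym/eqP.
  rewrite mulf_eq0 (subr_eq0 y) (gt_eqF xy) orbF /D2 mulf_eq0 gt_eqF/=; last first.
    by apply: g20; move/andP: al1 => [_ /lt_trans]; apply.
  by rewrite subr_eq0 => /eqP.
have xi1 : xi < 1 by exact: lt_trans s1.
have [al1 /andP[al1l al1r] K1] := root a xi axi xi1 D1a D1xi.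
have [al2 /andP[al2l al2r] K2] := root xi s xis s1 D1xi D1s.
have al12 : al1 < al2 by exact: lt_trans al2l.
have al21 : al2 < 1 by exact: lt_trans s1.
have rleft t : -1 <= t -> t <= a -> rho (ratio t) <= K.
  move=> t1 ta; rewrite leNgt; apply/negP => Kt.
  have := @rho_ratio_unimodal t al1 al2 t1 (le_lt_trans ta al1l) al12 al21.
  by rewrite K1 K2 ltxx => /(_ (ltW Kt)).
have rright t : s <= t -> t < 1 -> rho (ratio t) <= K.
  move=> st t1; have := @rho_ratio_unimodal al1 al2 t _ al12 (lt_le_trans al2r st) t1.
  rewrite K1 K2 => /(_ _ (lexx _))/ltW; apply; lra.
split.
- move=> t /andP[tm t1]; rewrite -subr_le0 opprD addrA -/(D t).
  have [ta|at_] := leP t a.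
    have D1_ge0 x : -1 <= x -> x <= a -> 0 <= D1 x.
      move=> xm; rewrite le_eqVlt => /predU1P[->|xa]; first by rewrite D1a.
      have [y /andP[y1 y2]] := mvtD1 _ _ xa a_1.
      rewrite D1a sub0r => e; rewrite -oppr_le0 e pmulr_lle0 ?subr_gt0//.
      rewrite leNgt D2_gt0 -?leNgt; last exact: lt_trans a_1.
      by apply: rleft; apply: ltW => //; exact: le_lt_trans y1.
    move: ta; rewrite le_eqVlt => /predU1P[->|ta]; first by rewrite Da.
    have [y /andP[y1 y2]] := mvtD _ _ ta a_1.
    rewrite Da sub0r => e; rewrite -oppr_ge0 e.
    apply: mulr_ge0; last by rewrite subr_ge0 ltW.
    by apply: D1_ge0; apply: ltW => //; exact: le_lt_trans y1.
  have [st|ts] := leP s t.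
    have D1_le0 x : s <= x -> x < 1 -> D1 x <= 0.
      rewrite le_eqVlt => /predU1P[<-|sx] x1; first by rewrite D1s.
      have [y /andP[y1 y2]] := mvtD1 _ _ sx x1.
      rewrite D1s subr0 => ->; rewrite pmulr_lle0 ?subr_gt0//.
      have y_1 := lt_trans y2 x1.
      by rewrite leNgt D2_gt0// -leNgt; apply: rright => //; exact: ltW.
    move: st; rewrite le_eqVlt => /predU1P[<-|st]; first by rewrite Ds.
    have [y /andP[y1 y2]] := mvtD _ _ st t1.
    rewrite Ds subr0 => ->; rewrite pmulr_lle0 ?subr_gt0//.
    by apply: D1_le0; [exact: ltW|exact: lt_trans t1].
  (* A positive value between a and s would make [D1] positive and then negative, hence [D2]
     positive, negative, positive: [rho] would be above, below and again above K. *)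
  rewrite leNgt; apply/negP => Dt.
  have [y1 /andP[y1l y1r] e1] := mvtD _ _ at_ t1.
  have [y2 /andP[y2l y2r] e2] := mvtD _ _ ts s1.
  have D1y1 : 0 < D1 y1.
    have : 0 < D1 y1 * (t - a) by rewrite -e1 Da subr0.
    by rewrite pmulr_lgt0// subr_gt0.
  have D1y2 : D1 y2 < 0.
    have : D1 y2 * (s - t) < 0 by rewrite -e2 Ds sub0r oppr_lt0.
    by rewrite pmulr_llt0// subr_gt0.
  have y12 : y1 < y2 by exact: lt_trans y2l.
  have y2_1 := lt_trans y2r s1.
  have [x1 /andP[x1l x1r] d1] := mvtD1 _ _ y1l (lt_trans y12 y2_1).
  have [x2 /andP[x2l x2r] d2] := mvtD1 _ _ y12 y2_1.
  have [x3 /andP[x3l x3r] d3] := mvtD1 _ _ y2r s1.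
  have x12 := lt_trans x1r x2l; have x23 := lt_trans x2r x3l.
  have x3_1 := lt_trans x3r s1; have x2_1 := lt_trans x23 x3_1.
  have K_1 : K < rho (ratio x1).
    rewrite -D2_gt0; last exact: lt_trans x2_1.
    have : 0 < D2 x1 * (y1 - a) by rewrite -d1 D1a subr0.
    by rewrite pmulr_lgt0// subr_gt0.
  have K_2 : rho (ratio x2) < K.
    rewrite -D2_lt0//.
    have : D2 x2 * (y2 - y1) < 0 by rewrite -d2 subr_lt0; exact: lt_trans D1y1.
    by rewrite pmulr_llt0// subr_gt0.
  have K_3 : K < rho (ratio x3).
    rewrite -D2_gt0//.
    have : 0 < D2 x3 * (s - y2) by rewrite -d3 D1s sub0r oppr_gt0.
    by rewrite pmulr_lgt0// subr_gt0.
  have := rho_ratio_unimodal (ltW (le_lt_trans a1 x1l)) x12 x23 x3_1.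
  move=> /(_ (ltW (lt_trans K_2 K_1)))/(lt_trans K_3)/lt_trans/(_ K_2).
  by rewrite ltxx.
- by move=> t /andP[]; exact: rright.
- exact: rleft.
- by exists al1 => //; rewrite al1l (lt_trans al1r).
Qed.

End Unimodal.

(** The end t = 1 stands for the points with x = 0, which the majorant in the plane must cover
    too. *)
Definition admissible z K A : Prop :=
  forall t, -1 <= t <= 1 -> f t - K * g t <= A * (t - z).

(** At t = 1 a limit from the left is taken. Near 1 one has g t <= 1 - t, so K g may be replaced by
    K (1 - t), which is differentiable at 1 and vanishes there. *)
Lemma admissible_closed z K A : 0 <= K ->
  (forall t, -1 <= t < 1 -> f t - K * g t <= A * (t - z)) -> admissible z K A.
Proof.
have [p1 p2] := andP hp.
move=> K0 H t /andP[tm]; rewrite le_eqVlt => /predU1P[->|t1]; last by apply: H; rewrite tm.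
rewrite {1}/Defs.g subrr powR0 ?mulr0 ?subr0; last lra.
pose w t := f t - A * (t - z) - K * (1 - t).
have r0 : 0 < radius2 1 by apply: radius2_gt0; lra.
have Hf := @is_derive_f R p tau 1 r0.
have cw : {for (1 : R), continuous w}.
  apply/differentiable_continuous/derivable1_diffP; rewrite /w.
  by apply: derivableB; [apply: derivableB|].
suff w1 : w 1 <= 0 by move: w1; rewrite /w subrr mulr0 subr0; lra.
rewrite leNgt; apply/negP => w1.
have : \forall t \near (1 : R)^'-, 0 < w t.
  apply: (@cvgr_gt _ _ _ _ _ (w 1)) => //.
  exact: cvg_at_left_filter.
move=> h.
have h2 : \forall t \near (1 : R)^'-, 0 < t < 1.
  near=> t'; apply/andP; split; near: t'; [exact: nbhs_left_gt|exact: nbhs_left_lt].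
have [t' [wt' /andP[t0 t1]]] := @filter_ex _ _ (at_left_proper_filter (1 : R)) _ (filterI h h2).
have : f t' - K * g t' <= A * (t' - z) by apply: H; rewrite t1; lra.
have gt : g t' <= 1 - t'.
  by rewrite /Defs.g; apply: ge1r_powR; lra.
have := ler_wpM2l K0 gt.
rewrite /w in wt'; lra.
Unshelve. all: by end_near. Qed.

Lemma admissible_slope_gt0 z K A : z < 1 -> admissible z K A -> 0 < A.
Proof.
have [p1 p2] := andP hp.
move=> z1 /(_ 1); rewrite lexx andbT => /(_ ltac:(lra)).
rewrite {1}/Defs.g subrr powR0 ?mulr0 ?subr0; last lra.
move=> H; have f0 : 0 < f 1 by rewrite /Defs.f powR_gt0//; apply: radius2_gt0; lra.
have : 0 < A * (1 - z) by exact: lt_le_trans H.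
by rewrite pmulr_lgt0// subr_gt0.
Qed.

(** For s = |x| + |y| and t = (|y| - |x|) / s, the point (|x|, |y|) is (1 - t, 1 + t) scaled by s /
    2, and s (t - z) = (1 - z) (|y| - b |x|) with b = [ratio z]. Hence the multiple A (1 - z)
    2^(-p). *)
Lemma admissible_transform z K A beta : -1 + 2 / p <= z < 1 -> 0 < K ->
  admissible z K A -> 0 <= beta -> (beta - 1) / (beta + 1) <= z ->
  transform_bound p tau beta K.
Proof.
have [p1 p2] := andP hp.
move=> /andP[z0 z1] K0 adm b0 bz.
have A0 := admissible_slope_gt0 z1 adm.
have pz : 2 - p <= z * p.
  have : (-1 + 2 / p) * p <= z * p by rewrite ler_wpM2r//; lra.
  by rewrite mulrDl divfK; lra.
apply: (@transform_bound_majorant R p tau beta K (A * (1 - z) * 2 `^ (- p)) (ratio z)) => //.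
- rewrite /ratio mulrAC ler_pdivlMr; lra.
- rewrite /ratio ler_pdivlMr; last lra.
  move: bz; rewrite ler_pdivrMr; lra.
- by rewrite !mulr_ge0 ?powR_ge0//; lra.
move=> x y; pose s := `|x| + `|y|.
have [s0|s0] := leP s 0.
  have [x0 y0] : x = 0 /\ y = 0.
    have := normr_ge0 x; have := normr_ge0 y; rewrite /s in s0 => h1 h2.
    by split; apply/eqP; rewrite -normr_eq0; apply/eqP; lra.
  rewrite x0 y0 /burkholder !normr0 expr0n/= mulr0 !addr0 !mulr0 subrr !mulr0 !powR0; lra.
pose t := (`|y| - `|x|) / s.
have nx := normr_ge0 x; have ny := normr_ge0 y.
have t1 : -1 <= t <= 1.
  by rewrite /t ler_pdivlMr// ler_pdivrMr// /s; apply/andP; split; lra.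
have := adm t t1.
have E1 : 1 + t = `|y| * (2 / s) by rewrite /t /s; field; rewrite /s in s0; lra.
have E2 : 1 - t = `|x| * (2 / s) by rewrite /t /s; field; rewrite /s in s0; lra.
have l0 : 0 <= 2 / s by rewrite divr_ge0// ltW.
have -> : f t = (tau ^+ 2 * x ^+ 2 + y ^+ 2) `^ (p / 2) * (2 / s) `^ p.
  rewrite /Defs.f E1 E2 (exprMn _ `|y|) (exprMn _ `|x|) !real_normK ?num_real//.
  have -> : y ^+ 2 * (2 / s) ^+ 2 + T * (x ^+ 2 * (2 / s) ^+ 2) =
    (T * x ^+ 2 + y ^+ 2) * (2 / s) ^+ 2 by ring.
  rewrite powRM ?sqr_ge0//; last first.
    by apply: addr_ge0; [apply: mulr_ge0|]; exact: sqr_ge0.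
  by rewrite powR_sqr//; congr (_ * _ `^ _); field.
have -> : g t = `|x| `^ p * (2 / s) `^ p by rewrite /Defs.g E2 powRM.
have s20 : 0 < (2 / s) `^ p by rewrite powR_gt0// divr_gt0.
rewrite mulrA -mulrBl -ler_pdivlMr// => H; apply: le_trans H _.
rewrite le_eqVlt; apply/orP; left; apply/eqP.
have -> : (2 / s) `^ p = 2 `^ p / s `^ p.
  rewrite powRM ?invr_ge0 ?(ltW s0)//; congr (_ * _).
  by rewrite -(powR_inv1 (ltW s0)) -powRrM mulN1r powRN.
rewrite /burkholder -/s powRN.
have -> : s `^ p = s * s `^ (p - 1) by rewrite -powRS//; congr (_ `^ _); ring.
have sp0 : 0 < s `^ (p - 1) by rewrite powR_gt0.
have tp0 : 0 < 2 `^ p :> R by rewrite powR_gt0.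
have xE : `|x| = s - `|y| by rewrite /s; ring.
rewrite /t /ratio xE; move: s0 sp0 tp0 z1; clear; clearbody s => s0 sp0 tp0 z1; field.
by rewrite !gt_eqF//; lra.
Qed.

End Bitangent.

(** * Tangent lines and the case u (1 / (p - 1)) <= 0 *)

Section Extension.
Context {R : realType}.
Variables (p tau : R).
Hypothesis hp : 1 < p < 2.
Implicit Types (t y z K A : R).

Local Notation T := (tau ^+ 2).
Local Notation f := (f p tau).
Local Notation g := (g p).
Local Notation f1 := (f1 p tau).
Local Notation f2 := (f2 p tau).
Local Notation g1 := (g1 p).
Local Notation g2 := (g2 p).
Local Notation rho := (rho p tau).
Local Notation phi := (phi p tau).
Local Notation radius2 := (radius2 tau).
Local Notation admissible := (admissible p tau).

(** Put K1 = phi (ratio s1) <= K = phi (ratio s). To the right of s1, f - K g is concave because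
    [rho] is at most K1 there, so it lies below its tangent at s. To the left, f - K1 g is below its
    tangent at s1 and g is above its own, so f - K g is below its tangent at s1; by concavity the
    tangent at s is higher still. *)
Lemma admissible_extend s1 s : -1 < s1 -> s1 <= s -> s < 1 ->
  (forall t, -1 <= t < 1 -> f t - phi (ratio s1) * g t <=
     (f1 s1 - phi (ratio s1) * g1 s1) * (t - s1)) ->
  (forall t, s1 <= t < 1 -> rho (ratio t) <= phi (ratio s1)) ->
  admissible s (phi (ratio s)) (f1 s - phi (ratio s) * g1 s).
Proof.
have [p1 p2] := andP hp.
move=> s1m s1s s_1 adm1 hr; set K1 := phi (ratio s1); set K := phi (ratio s).
have s11 : s1 < 1 by exact: le_lt_trans s_1.
have rpos t : -1 < t -> t < 1 -> 0 < ratio t by exact: ratio_gt0.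
have K1K : K1 <= K.
  apply: ler_phi => //; first by apply: ltW; exact: rpos.
  by move: s1s; rewrite le_eqVlt => /predU1P[->//|h]; apply: ltW; exact: ltr_ratio.
have K10 : 0 < K1 by apply: phi_gt0; exact: rpos.
pose V t := f t - K * g t; pose V1 t := f1 t - K * g1 t.
have B x y : s1 <= x -> x <= y -> y < 1 -> V1 y * (y - x) <= V y - V x <= V1 x * (y - x).
  move=> x1 xy y1; apply: tangent_bounds => //.
    move=> t /andP[xt ty]; apply: is_derive_gap; first exact: le_lt_trans y1.
    by apply: radius2_gt0; lra.
  move=> v w xv vw wy.
  have V2w t : v <= t <= w -> is_derive t 1 V1 (g2 t * (rho (ratio t) - K)).
    move=> /andP[vt tw]; apply: is_derive_gap1 => //; first lra.
    by apply: radius2_gt0; lra.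
  move: vw; rewrite le_eqVlt => /predU1P[->//|vw].
  have [t /andP[t1 t2] e] := mvt vw V2w.
  rewrite -subr_le0 e pmulr_lle0 ?subr_gt0//.
  rewrite pmulr_rle0; last by apply: g2_gt0 => //; lra.
  by rewrite subr_le0; apply: le_trans K1K; apply: hr; lra.
have Vs : V s = 0 by rewrite /V f_phi// mulrC subrr.
apply: admissible_closed => //; first exact: le_trans (ltW K10) K1K.
move=> t /andP[tm t1]; rewrite -/(V t) -/(V1 s).
have [s1t|ts1] := leP s1 t.
  have [ts|st] := leP t s.
    have /andP[+ _] := B t s s1t ts s_1.
    have -> : V1 s * (t - s) = - (V1 s * (s - t)) by ring.
    by rewrite Vs; lra.
  have /andP[_] := B s t s1s (ltW st) t1.
  by rewrite Vs subr0.
have /andP[H1 H2] := B s1 s (lexx _) s1s s_1.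
have V1s : V1 s <= V1 s1.
  move: s1s; rewrite le_eqVlt => /predU1P[->//|s1s].
  by have := le_trans H1 H2; rewrite ler_pM2r// subr_gt0.
have gt := @g_tangent R p hp s1 t s11 t1.
have fs1 : f s1 = K1 * g s1 by rewrite f_phi// mulrC.
have a1 := adm1 t; rewrite -/K1 tm t1 /= in a1; have {}a1 := a1 isT.
have c1 : 0 <= (K - K1) * (g t - (g s1 + g1 s1 * (t - s1))).
  by apply: mulr_ge0; lra.
have c2 : 0 <= (V1 s1 - V1 s) * (s1 - t) by apply: mulr_ge0; lra.
have V1E : V1 s1 = f1 s1 - K1 * g1 s1 - (K - K1) * g1 s1 by rewrite /V1; ring.
have VtE : V t = f t - K1 * g t - (K - K1) * g t by rewrite /V; ring.
have Vs1E : V s1 = - ((K - K1) * g s1) by rewrite /V fs1; ring.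
rewrite Vs in H1.
have c3 : V1 s * (t - s) = - (V1 s * (s - s1)) - V1 s * (s1 - t) by ring.
have c4 : (V1 s1 - V1 s) * (s1 - t) = V1 s1 * (s1 - t) - V1 s * (s1 - t) by ring.
have c5 : V1 s1 * (s1 - t) = - ((f1 s1 - K1 * g1 s1) * (t - s1)) + (K - K1) * (g1 s1 * (t - s1)).
  by rewrite V1E; ring.
rewrite mulrBr mulrDr in c1.
lra.
Qed.

(** * The tangent at -1 + 2 / p *)

Let z : R := (p - 1)^-1.
Let t0 : R := -1 + 2 / p.
Let Q y : R := T + y ^+ 2.
Let A : R := Q z `^ (p / 2 - 1) * (1 + z) `^ (2 - p).
(** Up to the factor [g t], [E (ratio t)] is the excess of f - phi z * g over its tangent at [t0];
    [A] is chosen so that [E1 z = 0]. For z = 1 / (p - 1) the derivative of (1 + y)^(p-1) (y - z) is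
    p y (1 + y)^(p-2), whence the factor y in [E1]. *)
Let E y : R := phi y - phi z - A * ((1 + y) `^ (p - 1) * (y - z)).
Let E1 y : R := p * y * (Q y `^ (p / 2 - 1) - A * (1 + y) `^ (p - 2)).
(** Since p / 2 - 1 < 0, for y > 0 the sign of [E1 y] is opposite to that of (z - y) [m y], and [m]
    is affine in y. *)
Let m y : R := T * (2 + y + z) - (y + z + 2 * y * z).

Let z_gt1 : 1 < z.
Proof.
have [p1 p2] := andP hp.
have pz : (p - 1) * z = 1 by rewrite /z mulfV; lra.
rewrite ltNge; apply/negP => zl.
have : 0 <= (p - 1) * (1 - z) by apply: mulr_ge0; lra.
lra.
Qed.

Let pzE : (p - 1) * z = 1.
Proof. by have [p1 p2] := andP hp; rewrite /z mulfV; lra. Qed.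

Let Qz_gt0 : 0 < Q z.
Proof. have z1 := z_gt1; rewrite /Q ltr_wpDl ?sqr_ge0// exprn_gt0//; lra. Qed.

Let is_derive_E y : 0 <= y -> 0 < Q y -> is_derive y 1 E (E1 y).
Proof.
have [p1 p2] := andP hp; have z1 := z_gt1.
move=> y0 Qy; have y10 : 0 < 1 + y by lra.
have HQ : is_derive y 1 Q (2 * y).
  by rewrite /Q; apply: is_derive_eq; rewrite /GRing.scale/=; ring.
have H1 := is_derive_powR_comp (p / 2) HQ Qy.
have Hy : is_derive y 1 (fun y : R => 1 + y) 1.
  by apply: is_derive_eq; ring.
have H2 := is_derive_powR_comp (p - 1) Hy y10.
rewrite /E /E1 /phi -/(Q y); apply: is_derive_eq; rewrite /GRing.scale/=.
have -> : p - 1 - 1 = p - 2 by ring.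
have -> : p - 1 = p - 2 + 1 by ring.
rewrite powRS//; set W := _ `^ (p - 2); set X := _ `^ (p / 2 - 1).
have -> : p = z^-1 + 1 by rewrite /z invrK; ring.
field; lra.
Qed.

Let Q_cmp y : Q y * (1 + z) ^+ 2 - Q z * (1 + y) ^+ 2 = (z - y) * m y.
Proof. by rewrite /Q /m; ring. Qed.

Let AE y : 0 <= y -> A * (1 + y) `^ (p - 2) =
  (Q z * (1 + y) ^+ 2 / (1 + z) ^+ 2) `^ (p / 2 - 1).
Proof.
have z1 := z_gt1.
move=> y0; rewrite -mulrA -expr_div_n powRM ?sqr_ge0 ?(ltW Qz_gt0)//.
rewrite powR_sqr ?divr_ge0//; [|lra..].
have -> : 2 * (p / 2 - 1) = p - 2 by field.
rewrite /A -mulrA; congr (_ * _).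
rewrite powRM ?invr_ge0; [|lra..].
rewrite mulrC; congr (_ * _).
have z10 : 0 <= 1 + z by lra.
by rewrite -(powR_inv1 z10) -powRrM mulN1r opprB.
Qed.

Let E1_ge0 y : 0 < y -> (z - y) * m y <= 0 -> 0 <= E1 y.
Proof.
have [p1 p2] := andP hp; have z1 := z_gt1.
move=> y0 h; apply: mulr_ge0; first by apply: mulr_ge0; lra.
have Qy : 0 < Q y by rewrite /Q ltr_wpDl ?sqr_ge0// exprn_gt0.
rewrite subr_ge0 AE; last lra.
apply: powR_nincr => //; first lra.
rewrite ler_pdivlMr; last by rewrite exprn_gt0//; lra.
by rewrite -subr_le0 Q_cmp.
Qed.

Let E1_lt0 y : 0 < y -> 0 < (z - y) * m y -> E1 y < 0.
Proof.
have [p1 p2] := andP hp; have z1 := z_gt1.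
move=> y0 h; rewrite /E1 pmulr_rlt0; last by rewrite mulr_gt0//; lra.
have Qy : 0 < Q y by rewrite /Q ltr_wpDl ?sqr_ge0// exprn_gt0.
rewrite subr_lt0 AE; last lra.
set Y := Q z * _ / _; have Y0 : 0 < Y.
  rewrite /Y; apply: divr_gt0; last by apply: exprn_gt0; lra.
  by apply: mulr_gt0; [exact: Qz_gt0|apply: exprn_gt0; lra].
have YQ : Y < Q y.
  rewrite /Y ltr_pdivrMr; last by rewrite exprn_gt0//; lra.
  by rewrite -subr_gt0 Q_cmp.
rewrite -(opprK (p / 2 - 1)) !(powRN _ (- (p / 2 - 1))) ltf_pV2 ?posrE ?powR_gt0//.
by apply: gt0_ltr_powR; rewrite ?nnegrE ?ltW//; lra.
Qed.

Let E1_le0 y : 0 < y -> 0 <= (z - y) * m y -> E1 y <= 0.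
Proof.
move=> y0; rewrite le_eqVlt => /predU1P[h|h]; last by apply: ltW; exact: E1_lt0.
have Qy : 0 < Q y by rewrite /Q ltr_wpDl ?sqr_ge0// exprn_gt0.
rewrite /E1 AE ?(ltW y0)//; have := Q_cmp y; rewrite -h => /eqP.
rewrite subr_eq0 => /eqP <-; rewrite mulfK ?subrr ?mulr0//.
by rewrite expf_neq0// gt_eqF//; have := z_gt1; lra.
Qed.

Let Ez : E z = 0.
Proof. by rewrite /E !subrr mulr0 mulr0 subr0. Qed.

(** This explains u: its sign at 1 / (p - 1) tells whether, at t = -1, the curve lies above or below
    the tangent at [t0]. *)
Lemma u_E : u p tau (1 / (p - 1)) = (p - 1) * Q z `^ ((2 - p) / 2) * E 0.
Proof.
have [p1 p2] := andP hp; have z1 := z_gt1.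
have -> : 1 / (p - 1) = z by rewrite /z mul1r.
have phi0 : phi 0 = `|tau| `^ p.
  rewrite /phi expr0n/= addr0 -real_normK ?num_real// powR_sqr//.
  by congr (_ `^ _); field.
have Qa : phi z * Q z `^ ((2 - p) / 2) = Q z.
  rewrite /phi -/(Q z) -powRD; last by rewrite (gt_eqF Qz_gt0) implybT.
  by rewrite (_ : p / 2 + (2 - p) / 2 = 1) ?powRr1 ?(ltW Qz_gt0)//; field.
have Qb : Q z `^ (p / 2 - 1) * Q z `^ ((2 - p) / 2) = 1.
  rewrite -powRD; last by rewrite (gt_eqF Qz_gt0) implybT.
  by rewrite (_ : p / 2 - 1 + (2 - p) / 2 = 0) ?powRr0//; field.
rewrite /u /E phi0 /A addr0 powR1 sub0r mul1r -/(Q z).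
set W := Q z `^ ((2 - p) / 2); rewrite -/W in Qa Qb.
set X := (1 + z) `^ (2 - p).
transitivity ((p - 1) *
  (`|tau| `^ p * W - phi z * W + Q z `^ (p / 2 - 1) * W * X * z)); last by ring.
rewrite Qa Qb mul1r.
have -> : (p - 1) * (`|tau| `^ p * W - Q z + X * z) =
   `|tau| `^ p * (p - 1) * W - T * (p - 1) - ((p - 1) * z) * z + X * ((p - 1) * z).
  by rewrite /Q; ring.
have -> : z * (2 - p) = z - (p - 1) * z by ring.
by rewrite pzE; ring.
Qed.

Hypothesis u_le0 : u p tau (1 / (p - 1)) <= 0.

Let E0_le0 : E 0 <= 0.
Proof.
have [p1 p2] := andP hp.
by move: u_le0; rewrite u_E pmulr_rle0// mulr_gt0 ?powR_gt0//; lra.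
Qed.

(** If T > z, then [m] > 0 on [0, z], so [E] decreases strictly to [E z = 0] and [E 0] would be
    positive. *)
Let T_le_z : T <= z.
Proof.
have z1 := z_gt1; rewrite leNgt; apply/negP => zT.
have z0 : 0 < z by lra.
have Tp : 0 < T by exact: lt_trans zT.
have [|y /andP[y0 yz]] := @mvt R E E1 0 z z0.
  move=> y /andP[y0 _]; apply: is_derive_E => //.
  by rewrite /Q ltr_wpDr ?sqr_ge0.
rewrite Ez sub0r subr0 => e.
have my : 0 < m y.
  have h1 : 0 < (T - z) * (2 + y + z) by apply: mulr_gt0; lra.
  have h2 : 0 <= (z - y) * (1 + z) by apply: mulr_ge0; lra.
  rewrite /m; lra.
have : E1 y < 0 by apply: E1_lt0 => //; apply: mulr_gt0; lra.
rewrite -(pmulr_llt0 _ z0) -e; have := E0_le0; lra.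
Qed.

(** As [m] decreases and is nonpositive at z, [E] decreases beyond z, while on [0, z] it can only
    decrease and then increase. So it is bounded by the larger of [E 0] and [E z]. *)
Let E_le0 y : 0 <= y -> E y <= 0.
Proof.
have z1 := z_gt1; have Tz := T_le_z; have T0 := sqr_ge0 tau.
rewrite le_eqVlt => /predU1P[<-|y0]; first exact: E0_le0.
have dE (a b : R) : 0 < a -> forall x, a <= x <= b -> is_derive x 1 E (E1 x).
  move=> a0 x /andP[ax _]; have x0 : 0 < x by exact: lt_le_trans ax.
  by apply: is_derive_E; rewrite ?ltW// /Q ltr_wpDl ?sqr_ge0// exprn_gt0.
have m_nincr (x1 x2 : R) : x1 <= x2 -> m x2 <= m x1.
  move=> x12; rewrite /m.
  have : 0 <= (1 + 2 * z - T) * (x2 - x1) by apply: mulr_ge0; lra.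
  lra.
have mz : m z <= 0.
  have : 0 <= (z - T) * (1 + z) by apply: mulr_ge0; lra.
  rewrite /m; lra.
have z0 : 0 < z by lra.
have [zy|yz|<-] := ltgtP z y; last by rewrite Ez.
  have [x /andP[zx xy]] := mvt zy (dE z y z0).
  rewrite Ez subr0 => ->; apply: mulr_le0_ge0; last lra.
  apply: E1_le0; first lra.
  by apply: mulr_le0; [lra|exact: le_trans (m_nincr _ _ (ltW zx)) mz].
have [my|my] := leP (m y) 0.
  have [x /andP[yx xz]] := mvt yz (dE y z y0).
  rewrite Ez sub0r => e; rewrite -oppr_ge0 e; apply: mulr_ge0; last lra.
  apply: E1_ge0; first lra.
  by apply: mulr_ge0_le0; [lra|exact: le_trans (m_nincr _ _ (ltW yx)) my].
(* T > 0 makes [E] differentiable at 0, where the mean value theorem starts. *)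
have Tp : 0 < T.
  have m0 : 0 < m 0 by apply: lt_le_trans my (m_nincr _ _ (ltW y0)).
  have : 0 < T * (2 + z) by rewrite /m in m0; lra.
  by rewrite pmulr_lgt0//; lra.
have [|x /andP[x0 xy]] := @mvt R E E1 0 y y0.
  move=> x /andP[x0 _]; apply: is_derive_E => //.
  by rewrite /Q ltr_wpDr ?sqr_ge0.
rewrite subr0 => e.
have : E1 x * y <= 0.
  rewrite pmulr_lle0//; apply: E1_le0 => //; apply: mulr_ge0; first lra.
  by apply: ltW; apply: lt_le_trans my (m_nincr _ _ (ltW xy)).
rewrite -e; have := E0_le0; lra.
Qed.

(** After factoring out a power of [Q], both factors of [rho y] are bounded by their values at z;
    what remains is the sign of z - T. *)
Let rho_le y : z <= y -> rho y <= phi z.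
Proof.
have [p1 p2] := andP hp; have z1 := z_gt1; have Tz := T_le_z; have T0 := sqr_ge0 tau.
move=> zy; have y0 : 0 < y by lra.
have Qy : 0 < Q y by rewrite /Q ltr_wpDl ?sqr_ge0// exprn_gt0.
have QQ : Q z <= Q y by rewrite /Q lerD2l; apply: lerXn2r => //; rewrite nnegrE; lra.
have hyz : (1 + y) ^+ 2 / Q y <= (1 + z) ^+ 2 / Q z.
  rewrite ler_pdivrMr// mulrAC ler_pdivlMr ?Qz_gt0//.
  rewrite -subr_ge0 [X in X - _]mulrC [X in _ - X]mulrC Q_cmp.
  apply: mulr_le0; first lra.
  have h1 : 0 <= (z - T) * (2 + y + z) by apply: mulr_ge0; lra.
  have h2 : 0 <= (y - z) * (z - 1) by apply: mulr_ge0; lra.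
  have h3 : 0 <= (z - 1) * (1 + z) by apply: mulr_ge0; lra.
  rewrite /m; nra.
have kE : (2 - p) / (p - 1) = z - 1.
  by rewrite /z; field; lra.
have -> : rho y = Q y `^ (p / 2 - 1) * ((T + 1) + (z - 1) * T * ((1 + y) ^+ 2 / Q y)).
  rewrite /rho kE -/(Q y) (_ : p / 2 - 1 = p / 2 - 2 + 1); last by ring.
  by rewrite powRS//; field; rewrite gt_eqF.
have -> : phi z = Q z `^ (p / 2 - 1) * Q z.
  by rewrite /phi -/(Q z) [RHS]mulrC -powRS ?Qz_gt0//; congr (_ `^ _); ring.
have zT : 0 <= (z - 1) * T by apply: mulr_ge0; lra.
have Y0 : 0 <= (1 + y) ^+ 2 / Q y by rewrite divr_ge0 ?sqr_ge0// ltW.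
apply: ler_pM; [exact: powR_ge0|by apply: addr_ge0; [lra|exact: mulr_ge0]|..].
  by apply: powR_nincr => //; lra.
apply: le_trans (_ : T + 1 + (z - 1) * T * ((1 + z) ^+ 2 / Q z) <= _).
  by rewrite lerD2l ler_wpM2l.
rewrite -subr_ge0.
have -> : Q z - (T + 1 + (z - 1) * T * ((1 + z) ^+ 2 / Q z)) =
   (z - 1) * (1 + z) * (z * (z - T)) / Q z.
  by rewrite /Q; field; rewrite gt_eqF//; exact: Qz_gt0.
by rewrite divr_ge0 ?(ltW Qz_gt0)// !mulr_ge0//; lra.
Qed.

Let ratio_t0 : ratio t0 = z.
Proof. by have [p1 p2] := andP hp; rewrite /ratio /t0 /z; field; lra. Qed.

Let t0_bounds : 0 < t0 < 1.
Proof.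
have [p1 p2] := andP hp; rewrite /t0.
have -> : -1 + 2 / p = (2 - p) / p by field; lra.
by rewrite divr_gt0 ?ltr_pdivrMr//=; lra.
Qed.

Lemma case_i_transform beta : 0 <= beta ->
  transform_bound p tau beta ((T + Num.max beta (1 / (p - 1)) ^+ 2) `^ (p / 2)).
Proof.
have [p1 p2] := andP hp; have [t01 t02] := andP t0_bounds; have z1 := z_gt1.
move=> b0; rewrite mul1r -/z; set b := Num.max beta z.
have zb : z <= b by rewrite /b le_max lexx orbT.
have bb : beta <= b by rewrite /b le_max lexx.
pose s := (b - 1) / (b + 1).
have rs : ratio s = b by rewrite /ratio /s; field; lra.
have t0s : t0 <= s.
  have t0E : t0 = (z - 1) / (z + 1) by rewrite /t0 /z; field; lra.
  rewrite t0E /s ler_pdivrMr; last lra.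
  rewrite mulrAC ler_pdivlMr; lra.
have s_1 : s < 1 by rewrite /s ltr_pdivrMr; lra.
have r0 t : -1 < t -> 0 < radius2 t by exact: radius2_gt0.
have adm : admissible s (phi (ratio s)) (f1 s - phi (ratio s) * g1 s).
  apply: (@admissible_extend t0) => //; first lra.
    move=> t /andP[tm t1]; rewrite f1_phi//; last by apply: r0; lra.
    rewrite ratio_t0.
    have t10 : 0 < 1 - t by lra.
    have gt := g_gt0 p t1.
    have := ler_wpM2l (ltW gt) (E_le0 (ratio_ge0 tm t1)).
    have -> : g t * E (ratio t) =
      f t - phi z * g t - A * (g t * ((1 + ratio t) `^ (p - 1) * (ratio t - z))).
      by rewrite /E f_phi//; ring.
    rewrite mulr0.
    have E1r : 1 + ratio t = 2 / (1 - t) by rewrite /ratio; field; lra.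
    have E2r : 1 - t0 = 2 / (1 + z) by rewrite /t0 /z; field; lra.
    have -> : g t * ((1 + ratio t) `^ (p - 1) * (ratio t - z)) =
       2 `^ (p - 1) * ((1 - t) * (ratio t - z)).
      rewrite E1r /Defs.g powRM ?invr_ge0//; last exact: ltW.
      have -> : p = p - 1 + 1 by ring.
      rewrite powRS// (_ : p - 1 + 1 - 1 = p - 1); last by ring.
      rewrite -(powR_inv1 (ltW t10)) -powRrM mulN1r powRN.
      have : 0 < (1 - t) `^ (p - 1) by rewrite powR_gt0.
      by set W := _ `^ _ => W0; field; rewrite gt_eqF.
    have -> : (1 - t0) `^ (p - 2) = 2 `^ (p - 2) * (1 + z) `^ (2 - p).
      have z10 : 0 <= 1 + z by lra.
      by rewrite E2r powRM ?invr_ge0// -(powR_inv1 z10) -powRrM mulN1r opprB.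
    have -> : p - 1 = p - 2 + 1 by ring.
    have pzE' : p * z = 1 + z by have := pzE; lra.
    rewrite powRS// pzE' -/(Q z) /A.
    set W := _ `^ (p - 2); set X := _ `^ (p / 2 - 1); set Y := _ `^ (2 - p).
    have -> : (1 - t) * (ratio t - z) = (1 + z) * (t - t0).
      by rewrite /ratio /t0 /z; field; lra.
    lra.
  by move=> t /andP[t0t t1]; rewrite ratio_t0; apply: rho_le; rewrite -ratio_t0;
    move: t0t; rewrite le_eqVlt => /predU1P[->//|h]; apply: ltW; exact: ltr_ratio.
rewrite rs in adm.
apply: (admissible_transform hp _ _ adm) => //.
- by rewrite s_1 -/t0 t0s.
- by apply: phi_gt0; lra.
rewrite /s ler_pdivrMr; last lra.
rewrite mulrAC ler_pdivlMr; lra.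
Qed.

End Extension.

(** * The least admissible constant *)

Section Optimal.
Context {R : realType}.
Variables (p tau : R).
Hypothesis hp : 1 < p < 2.
Implicit Types (t y z K A : R).

Local Notation T := (tau ^+ 2).
Local Notation f := (f p tau).
Local Notation g := (g p).
Local Notation f1 := (f1 p tau).
Local Notation g1 := (g1 p).
Local Notation phi := (phi p tau).
Local Notation rho := (rho p tau).
Local Notation admissible := (admissible p tau).
Local Notation bitangent := (bitangent p tau).

Definition optimal z K : Prop :=
  (exists A, admissible z K A) /\ forall K' A', admissible z K' A' -> K <= K'.

Lemma optimal_unique z K K' : optimal z K -> optimal z K' -> K = K'.
Proof.
move=> [[A hA] hK] [[A' hA'] hK'].
by apply/eqP; rewrite eq_le (hK _ _ hA') (hK' _ _ hA).
Qed.

Lemma admissible_ge_phi z K A : -1 <= z < 1 -> admissible z K A -> phi (ratio z) <= K.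
Proof.
move=> /andP[zm z1] /(_ z); rewrite zm (ltW z1) subrr mulr0 => /(_ isT).
rewrite f_phi// mulrC -mulrBl pmulr_lle0 ?subr_le0//; exact: g_gt0.
Qed.

Lemma admissible_gt0 z K A : -1 < z < 1 -> admissible z K A -> 0 < K.
Proof.
move=> /andP[zm z1] adm; have zz : -1 <= z < 1 by rewrite ltW.
by apply: lt_le_trans (admissible_ge_phi zz adm); apply: phi_gt0; exact: ratio_gt0.
Qed.

Lemma optimal_touching z A : -1 <= z < 1 -> admissible z (phi (ratio z)) A ->
  optimal z (phi (ratio z)).
Proof.
by move=> z1 adm; split; [exists A|move=> K' A'; exact: admissible_ge_phi].
Qed.

Lemma bitangent_admissible a s z K A : 0 < T -> -1 <= a -> a < s -> s < 1 ->
  -1 < z < 1 -> bitangent a s K A -> f s - K * g s = A * (s - z) -> admissible z K A.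
Proof.
move=> T0 a1 as_ s1 /andP[zm z1] bt e.
have [dom _ _ _] := bitangent_dominates hp T0 a1 as_ s1 bt.
have {}dom t : -1 <= t < 1 -> f t - K * g t <= A * (t - z).
  by move=> /dom; rewrite e -mulrDr; have -> : s - z + (t - s) = t - z by ring.
apply: admissible_closed => //.
have := dom z; rewrite (ltW zm) z1 subrr mulr0 => /(_ isT).
rewrite f_phi// mulrC -mulrBl pmulr_lle0 ?subr_le0; last exact: g_gt0.
by apply: le_trans; apply: ltW; apply: phi_gt0; exact: ratio_gt0.
Qed.

(* A smaller K would force the slope of an admissible line to be both smaller
   (because of the contact point a < z) and larger (because of s > z). *)
Lemma bitangent_optimal a s z K A : 0 < T -> -1 <= a -> a < z -> z < s -> s < 1 ->
  -1 < z < 1 -> bitangent a s K A -> f s - K * g s = A * (s - z) -> optimal z K.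
Proof.
move=> T0 a1 az zs s1 z1 bt e; have as_ := lt_trans az zs.
have a_1 : a < 1 by exact: lt_trans s1.
have adm := bitangent_admissible T0 a1 as_ s1 z1 bt e.
split; first by exists A.
move=> K' A' adm'; rewrite leNgt; apply/negP => KK.
have e' : f a - K * g a = A * (a - z).
  case: bt => _ _; rewrite e => h.
  have : A * (s - z) - A * (s - a) = A * (a - z) by ring.
  by rewrite -h; lra.
have ha := adm' a; rewrite a1 (ltW a_1) /= in ha; have {}ha := ha isT.
have hs := adm' s; rewrite (ltW s1) (le_trans a1 (ltW as_)) /= in hs; have {}hs := hs isT.
have ga : 0 < (K - K') * g a by rewrite mulr_gt0 ?subr_gt0// g_gt0.
have gs : 0 < (K - K') * g s by rewrite mulr_gt0 ?subr_gt0// g_gt0.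
have h1 : 0 < (A - A') * (z - a).
  have -> : (A - A') * (z - a) = A' * (a - z) - A * (a - z) by ring.
  lra.
have h2 : 0 < (A' - A) * (s - z).
  have -> : (A' - A) * (s - z) = A' * (s - z) - A * (s - z) by ring.
  lra.
by move: h1 h2; rewrite !pmulr_lgt0 ?subr_gt0//; lra.
Qed.

Lemma optimal_ndecr z z' K K' : z <= z' -> z' < 1 -> optimal z K -> optimal z' K' ->
  K <= K'.
Proof.
move=> zz z1 [_ min] [[A' adm'] _]; have A0 := admissible_slope_gt0 hp z1 adm'.
apply: (min _ A') => t t1; apply: le_trans (adm' t t1) _.
by rewrite ler_pM2l//; lra.
Qed.

Lemma g_nincr s t : s <= t -> t < 1 -> g t <= g s.
Proof.
by have [p1 p2] := andP hp; move=> st t1; apply: ge0_ler_powR; rewrite ?nnegrE; lra.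
Qed.

(* Steepening the line by d and raising K by e keeps it above the curve when
   its root moves from z to z': d works to the right of z' + eta, e to the left. *)
Lemma optimal_lipschitz zm Km : 0 <= zm < 1 -> optimal zm Km ->
  exists2 L, 0 <= L & forall z z' K K', 0 <= z -> z <= z' -> z' <= zm ->
    optimal z K -> optimal z' K' -> K' - K <= L * (z' - z).
Proof.
move=> /andP[zm0 zm1] om.
have [[Am admm] _] := om; have Km0 : 0 < Km by apply: admissible_gt0 admm; lra.
pose eta := (1 - zm) / 2; have eta0 : 0 < eta by rewrite /eta; lra.
have ze1 : zm + eta < 1 by rewrite /eta; lra.
have gam := g_gt0 p ze1; set gamma := g _ in gam.
have g10 : 0 < g (-1) by apply: g_gt0; lra.
exists (Km * g (-1) * (2 / eta + 1) / gamma).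
  rewrite divr_ge0 ?(ltW gam)// mulr_ge0//; first by rewrite mulr_ge0// ltW.
  by rewrite addr_ge0// divr_ge0// ltW.
move=> z z' K K' z0 zz zzm oK oK'; have [[A adm] _] := oK.
have z_1 : z < 1 by lra.
have A0 := admissible_slope_gt0 hp z_1 adm.
have K0 : 0 < K by apply: admissible_gt0 adm; lra.
have KKm : K <= Km by apply: optimal_ndecr oK om => //; lra.
(* The point t = -1 bounds the slope uniformly in z: A <= A (1 + z) <= K g(-1). *)
have AK : A <= Km * g (-1).
  have := adm (-1); rewrite lexx (_ : -1 <= 1); last lra.
  move=> /(_ isT) h; have f0 : 0 <= f (-1) by exact: powR_ge0.
  have h2 := ler_wpM2r (ltW g10) KKm.
  have h3 : 0 <= A * z by rewrite mulr_ge0// ltW.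
  lra.
(* To the left of z' + eta the steepening costs at most 2 d, because z' - t <= 2, and [gamma] is a
   lower bound of g there. *)
pose d := A * (z' - z) / eta; pose e := (2 * d + A * (z' - z)) / gamma.
have Az0 : 0 <= A * (z' - z) by rewrite mulr_ge0 ?subr_ge0// ltW.
have d0 : 0 <= d by rewrite divr_ge0// ltW.
have e0 : 0 <= e by rewrite divr_ge0 ?(ltW gam)//; lra.
have adm2 : admissible z' (K + e) (A + d).
  move=> t /andP[tm t1]; have h := adm t; rewrite tm t1 in h; have {}h := h isT.
  suff : A * (z' - z) <= e * g t + d * (t - z').
    have -> : (K + e) * g t = K * g t + e * g t by ring.
    have -> : (A + d) * (t - z') = A * (t - z) + d * (t - z') - A * (z' - z) by ring.
    by lra.
  have gt0 : 0 <= g t by exact: powR_ge0.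
  have [tz|tz] := leP (z' + eta) t.
    have : d * eta <= d * (t - z') by apply: ler_wpM2l => //; lra.
    rewrite {1}/d divfK ?gt_eqF// => h1.
    have := mulr_ge0 e0 gt0; lra.
  have gg : gamma <= g t by apply: g_nincr => //; lra.
  have := ler_wpM2l e0 gg; rewrite {1}/e divfK ?gt_eqF// => h1.
  have : 0 <= d * (t - z' + 2) by apply: mulr_ge0 => //; lra.
  lra.
have [_ /(_ _ _ adm2) h] := oK'.
apply: (@le_trans _ _ e); first lra.
have -> : e = A * ((2 / eta + 1) / gamma * (z' - z)).
  by rewrite /e /d; field; rewrite !gt_eqF.
rewrite [leRHS](_ : _ = Km * g (-1) * ((2 / eta + 1) / gamma * (z' - z))); last by ring.
rewrite ler_wpM2r//.
by rewrite mulr_ge0 ?subr_ge0// divr_ge0 ?(ltW gam)// addr_ge0// divr_ge0// ltW.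
Qed.

Definition optimal_constant z : R := xget 0 (optimal z).

Lemma optimal_constantE z K : optimal z K -> optimal_constant z = K.
Proof.
by move=> oK; apply: xget_unique => // K' oK'; exact: optimal_unique oK.
Qed.

Lemma continuous_optimal (t0 : R) : 0 <= t0 < 1 ->
  (forall z, t0 <= z < 1 -> exists K, optimal z K) ->
  forall x : R, x < 1 -> {for x, continuous (fun z => optimal_constant (Num.max z t0))}.
Proof.
move=> /andP[t00 t01] ex x x1.
have exm z : z < 1 -> optimal (Num.max z t0) (optimal_constant (Num.max z t0)).
  move=> z1; have [|K oK] := ex (Num.max z t0).
    by rewrite le_max lexx orbT gt_max z1.
  by rewrite (optimal_constantE oK).
(* The Lipschitz constant is uniform only for roots bounded away from 1, so the bound is put halfway
   between the point and 1. *)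
pose zm := (Num.max x t0 + 1) / 2.
have m1 : Num.max x t0 < 1 by rewrite gt_max x1.
have m0 : t0 <= Num.max x t0 by rewrite le_max lexx orbT.
have xm : x <= Num.max x t0 by rewrite le_max lexx.
have zm1 : 0 <= zm < 1 by rewrite /zm; lra.
have [|Km oKm] := ex zm; first by rewrite /zm; lra.
have [L L0 lip] := optimal_lipschitz zm1 oKm.
apply/cvgrPdist_lt => eps eps0.
near=> y.
have yzm : y < zm by near: y; apply: lt_nbhsl; rewrite /zm; lra.
have ye : `|x - y| < eps / (L + 1).
  near: y; apply: (@cvgr_dist_lt _ _ _ _ _ id) => //.
  by rewrite divr_gt0//; lra.
have t0zm : t0 <= zm by rewrite /zm; lra.
have main a b : a < zm -> b < zm -> a <= b ->
    `|optimal_constant (Num.max b t0) - optimal_constant (Num.max a t0)| <= L * (b - a).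
  move=> az bz ab; have zm_1 := andP zm1.
  have mab : Num.max a t0 <= Num.max b t0 by rewrite ge_max !le_max ab lexx orbT.
  have oa := exm a (lt_trans az zm_1.2); have ob := exm b (lt_trans bz zm_1.2).
  have mb1 : Num.max b t0 < 1 by rewrite gt_max (lt_trans bz zm_1.2).
  rewrite ger0_norm; last by rewrite subr_ge0; exact: optimal_ndecr oa ob.
  have mbz : Num.max b t0 <= zm by rewrite ge_max (ltW bz) t0zm.
  have ma0 : 0 <= Num.max a t0 by rewrite le_max t00 orbT.
  apply: le_trans (lip _ _ _ _ ma0 mab mbz oa ob) _.
  apply: ler_wpM2l => //.
  have [ta|ta] := leP t0 a; first by rewrite max_l ?(le_trans ta ab).
  have [tb|tb] := leP t0 b; first by rewrite lerD2l lerN2 ltW.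
  by rewrite subrr subr_ge0.
have xzm : x < zm by rewrite /zm; lra.
have h : `|optimal_constant (Num.max x t0) - optimal_constant (Num.max y t0)| <= L * `|x - y|.
  have [xy|yx] := leP x y.
    by rewrite distrC (distrC x) (ger0_norm (_ : 0 <= y - x)) ?subr_ge0//; exact: main.
  by rewrite (ger0_norm (_ : 0 <= x - y)) ?subr_ge0 ?(ltW yx)//; apply: main => //; exact: ltW.
apply: le_lt_trans h _.
have L1 : 0 < L + 1 by lra.
have h1 : (L + 1) * `|x - y| < eps by rewrite mulrC -ltr_pdivlMr.
apply: le_lt_trans h1; rewrite ler_wpM2r//; lra.
Unshelve. all: by end_near. Qed.

End Optimal.

(** * The cup *)

Section Cup.
Context {R : realType}.
Variables (p tau : R).
Hypothesis hp : 1 < p < 2.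
Implicit Types (t y z K A : R).

Local Notation T := (tau ^+ 2).
Local Notation f := (f p tau).
Local Notation g := (g p).
Local Notation f1 := (f1 p tau).
Local Notation g1 := (g1 p).
Local Notation phi := (phi p tau).
Local Notation rho := (rho p tau).
Local Notation admissible := (admissible p tau).
Local Notation bitangent := (bitangent p tau).
Local Notation optimal := (optimal p tau).

(** For tau = 0, u z is (1 + z)^(2-p) - 1 - (2 - p) z, which is nonpositive by Bernoulli's
    inequality. *)
Lemma u_gt0_tau : 0 < u p tau (1 / (p - 1)) -> 0 < T.
Proof.
have [p1 p2] := andP hp.
move=> u0; rewrite lt_neqAle sqr_ge0 andbT eq_sym sqrf_eq0; apply/eqP => tau0.
have z0 : 0 < 1 / (p - 1) by rewrite divr_gt0//; lra.
move: u0; rewrite /u tau0 normr0 powR0 ?expr0n/= ?mul0r ?subr0 ?add0r; last lra.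
set z := 1 / (p - 1) in z0 *; apply/negP; rewrite -leNgt.
have d1 t : 0 <= t <= z ->
    is_derive t 1 (fun t : R => (1 + t) `^ (2 - p)) ((2 - p) * (1 + t) `^ (2 - p - 1) * 1).
  move=> /andP[t0 _]; have H : is_derive t 1 (fun t : R => 1 + t) 1.
    by apply: is_derive_eq; ring.
  by apply: (is_derive_powR_comp (2 - p) H); lra.
have [t /andP[t0 tz]] := mvt z0 d1.
rewrite addr0 powR1 subr0 mulr1 /= => e.
have : (1 + t) `^ (2 - p - 1) <= 1 `^ (2 - p - 1) by apply: powR_nincr; lra.
rewrite powR1 /= => h.
have : 0 <= (2 - p) * (1 - (1 + t) `^ (2 - p - 1)) * z.
  by apply: mulr_ge0; [apply: mulr_ge0; lra|lra].
have -> : (2 - p) * (1 - (1 + t) `^ (2 - p - 1)) * z =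
  (2 - p) * z - (2 - p) * (1 + t) `^ (2 - p - 1) * z by ring.
rewrite -e; lra.
Qed.

(** The factor of [rho y - phi y] that decides its sign for y >= 0, see [rho_phi]. *)
Definition contact y : R := T * (1 + (3 - 2 * p) * y) + (p - 1) * y ^+ 2 * (1 - y).

Lemma rho_phi y : 0 < T -> rho y - phi y =
  (1 + y) * (T + y ^+ 2) `^ (p / 2 - 2) / (p - 1) * contact y.
Proof.
have [p1 p2] := andP hp.
move=> T0; have Q0 : 0 < T + y ^+ 2 by rewrite ltr_wpDr ?sqr_ge0.
rewrite /rho /phi (_ : p / 2 = p / 2 - 2 + 1 + 1); last by ring.
rewrite (_ : p / 2 - 2 + 1 + 1 - 1 = p / 2 - 2 + 1); last by ring.
rewrite (_ : p / 2 - 2 + 1 + 1 - 2 = p / 2 - 2); last by ring.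
rewrite !powRS//; set W := _ `^ _; rewrite /contact; field; lra.
Qed.

Lemma phi_rho_contact y : 0 < T -> 0 <= y ->
  (phi y <= rho y) = (0 <= contact y) /\ (phi y < rho y) = (0 < contact y).
Proof.
have [p1 p2] := andP hp.
move=> T0 y0; have pos : 0 < (1 + y) * (T + y ^+ 2) `^ (p / 2 - 2) / (p - 1).
  rewrite divr_gt0//; last lra.
  by rewrite mulr_gt0 ?powR_gt0 ?ltr_wpDr ?sqr_ge0//; lra.
by rewrite -subr_ge0 -[phi y < _]subr_gt0 rho_phi// pmulr_rge0// pmulr_rgt0.
Qed.

(** Up to 1 the cubic is positive. Beyond 1, contact y / y^2 decreases if 3 - 2p >= 0, and the cubic
    itself decreases otherwise. *)
Lemma contact_gt0 y1 y2 : 0 < T -> 0 <= y1 -> y1 < y2 -> 0 <= contact y2 -> 0 < contact y1.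
Proof.
have [p1 p2] := andP hp.
move=> T0 y10 y12; rewrite /contact => c2.
have [y11|y11] := leP y1 1.
  apply: ltr_pwDl; last by rewrite !mulr_ge0 ?sqr_ge0//; lra.
  apply: mulr_gt0 => //.
  have [h|h] := leP 0 (3 - 2 * p).
    by have := mulr_ge0 h y10; lra.
  have : 0 <= (2 * p - 3) * (1 - y1) by apply: mulr_ge0; lra.
  lra.
have y20 : 1 < y2 by lra.
have [h|h] := leP 0 (3 - 2 * p).
  have : 0 < y2 ^+ 2 * contact y1 - y1 ^+ 2 * contact y2.
    have -> : y2 ^+ 2 * contact y1 - y1 ^+ 2 * contact y2 = (y2 - y1) *
       (T * (y1 + y2 + (3 - 2 * p) * (y1 * y2)) + (p - 1) * (y1 ^+ 2 * y2 ^+ 2)).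
      by rewrite /contact; ring.
    apply: mulr_gt0; first lra.
    apply: ltr_pwDl; last by rewrite !mulr_ge0 ?sqr_ge0//; lra.
    apply: mulr_gt0 => //; apply: ltr_pwDl; first lra.
    by rewrite !mulr_ge0//; lra.
  have : 0 <= y1 ^+ 2 * contact y2 by rewrite mulr_ge0 ?sqr_ge0.
  move=> h1 h2; have : 0 < y2 ^+ 2 * contact y1 by lra.
  by rewrite pmulr_rgt0// exprn_gt0//; lra.
have h1 : 0 <= T * ((2 * p - 3) * (y2 - y1)).
  by apply: mulr_ge0; [exact: ltW|apply: mulr_ge0; lra].
have h2 : 0 < (p - 1) * ((y2 - y1) * ((y1 ^+ 2 + y1 * y2 + y2 ^+ 2) - (y1 + y2))).
  apply: mulr_gt0; first lra.
  apply: mulr_gt0; first lra.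
  have h3 : 0 < y1 * (y1 - 1) by apply: mulr_gt0; lra.
  have h4 : 0 < y2 * (y2 - 1) by apply: mulr_gt0; lra.
  have h5 : 0 < y1 * y2 by apply: mulr_gt0; lra.
  lra.
lra.
Qed.

Hypothesis T0 : 0 < T.

Lemma derive1_f t : f^`()%classic t = f1 t.
Proof.
have [_ e] := @is_derive_f R p tau t (radius2_gt0T t T0).
by rewrite derive1E e.
Qed.

Lemma derive1_g t : t < 1 -> g^`()%classic t = g1 t.
Proof. by move=> t1; have [_ e] := @is_derive_g R p t t1; rewrite derive1E e. Qed.

Lemma det_cup_matrix x s : x < 1 -> s < 1 -> \det (cup_matrix p tau x s) =
  (g1 s - g1 x) * (f x - f s) - (f1 s - f1 x) * (g x - g s)
  + (x - s) * (g1 x * f1 s - g1 s * f1 x).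
Proof.
move=> x1 s1; rewrite (expand_det_row _ 0) !big_ord_recr big_ord0 /= /cofactor.
rewrite !(expand_det_row _ 0) !big_ord_recr !big_ord0 /= /cofactor !det_mx11 !mxE /=.
by rewrite !derive1_f !derive1_g//; ring.
Qed.

(** Subtracting the two relations, (K' - K) g is at most an affine function at b and r, and at least
    that function at x in between. With K' > K this contradicts the strict convexity of g. *)
Lemma nested_contact b x r K m A K' m' A' : b < x -> x < r -> r < 1 ->
  f x - K * g x = m + A * x ->
  f b - K * g b <= m + A * b -> f r - K * g r <= m + A * r ->
  f x - K' * g x <= m' + A' * x ->
  f b - K' * g b = m' + A' * b -> f r - K' * g r = m' + A' * r -> K' <= K.
Proof.
move=> bx xr r1; have x1 : x < 1 by exact: lt_trans r1.
have b1 : b < 1 by exact: lt_trans x1.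
have nb : x != b by rewrite gt_eqF.
have nr : x != r by rewrite lt_eqF.
have := g_tangent_lt hp x1 r1 nr; have := g_tangent_lt hp x1 b1 nb.
move: (f x) (f b) (f r) (g x) (g b) (g r) (g1 x) => fx fb fr gx gb gr G.
clear nb nr b1 x1 r1 => hb hr ex eb er ex' eb' er'; rewrite leNgt; apply/negP => KK.
have dx : m - m' + (A - A') * x <= (K' - K) * gx by rewrite !mulrBl; lra.
have db : (K' - K) * gb <= m - m' + (A - A') * b by rewrite !mulrBl; lra.
have dr : (K' - K) * gr <= m - m' + (A - A') * r by rewrite !mulrBl; lra.
clear ex eb er ex' eb' er'; rewrite -subr_gt0 in KK.
move: (K' - K) (m - m') (A - A') KK dx db dr => d mu al d0 dx db dr.
have h1 : 0 < d * ((r - x) * (gb - (gx + G * (b - x)))) by rewrite !mulr_gt0// subr_gt0.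
have h2 : 0 < d * ((x - b) * (gr - (gx + G * (r - x)))) by rewrite !mulr_gt0// subr_gt0.
have h3 : 0 <= (r - b) * (d * gx - (mu + al * x)) by apply: mulr_ge0; lra.
have h4 : 0 <= (r - x) * (mu + al * b - d * gb) by apply: mulr_ge0; lra.
have h5 : 0 <= (x - b) * (mu + al * r - d * gr) by apply: mulr_ge0; lra.
lra.
Qed.

(** * Bitangent lines given by the cup function *)

Section CupFunction.
Variables (c s0 : R) (a : R -> R).
Hypothesis c_bounds : -1 < c < 1.
Hypothesis s0_lt1 : s0 < 1.
Hypothesis c_le_s0 : c <= s0.
Hypothesis hcup : is_cup_function p tau c s0 a.

Local Notation slope := (slope p tau a).
Local Notation Rfun := (Rfun p tau a).
(** The points (g', f') at s and [a s] lie on a line with slope [slope s] and this intercept. For K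
    = [slope s] it is therefore the common slope A of f - K g at both points. *)
Let intercept s := f1 s - slope s * g1 s.

Lemma cup_c_lt_s0 : c < s0.
Proof.
have [c1 _] := andP c_bounds; case: hcup => _ _ ac as0 _.
have cs := c_le_s0; rewrite lt_neqAle cs andbT; apply/eqP => e.
by move: c1; rewrite -as0 -e ac ltxx.
Qed.

(* A maximum of [a] over [x, y] attained away from x would give a
   nonnegative left difference quotient there. *)
Lemma cup_decreasing x y : c <= x -> x < y -> y <= s0 -> a y < a x.
Proof.
case: hcup => ca [a' [_ da' a'0]] _ _ _ cx xy ys0.
have cxy : {within `[x, y], continuous a}.
  apply: continuous_subspaceW ca => z; rewrite /= !in_itv/= => /andP[xz zy].
  by rewrite (le_trans cx xz) (le_trans zy ys0).
have nomax m : x < m -> m <= y -> ~ (forall t, t \in `[x, y] -> a t <= a m).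
  move=> xm my hmax; have cms : c < m <= s0 by rewrite (le_lt_trans cx xm) (le_trans my ys0).
  have q0 := a'0 m cms.
  have : \forall t \near within `]c, s0] m^', (a t - a m) / (t - m) < 0.
    by apply: (@cvgr_lt _ _ _ _ _ (a' m)) => //; exact: da'.
  rewrite /within /= => /nbhs_ballP[e /= e0 he].
  pose t := Num.max ((x + m) / 2) (m - e / 2).
  have xt : x < t by rewrite lt_max; apply/orP; left; lra.
  have tm : t < m by rewrite gt_max; apply/andP; split; lra.
  have et : m - e / 2 <= t by rewrite le_max lexx orbT.
  have bt : ball m e t by rewrite /ball /= ger0_norm; lra.
  have tc : `]c, s0]%classic t by rewrite /= in_itv/=; lra.
  have tnm : t != m by rewrite lt_eqF.
  have := he t bt tnm tc.
  have txy : t \in `[x, y] by rewrite in_itv/=; lra.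
  have := hmax t txy => h.
  rewrite ltNge => /negP; apply; apply: mulr_le0; first by rewrite subr_le0.
  by rewrite invr_le0 subr_le0 ltW.
have [m mxy hm] := EVT_max (ltW xy) cxy.
move: (mxy); rewrite in_itv/= => /andP[xm my].
have mx : m = x.
  have [//|mx] := eqVneq m x; exfalso; apply: (nomax m) => //.
  by rewrite lt_neqAle eq_sym mx.
rewrite mx in hm.
have yxy : y \in `[x, y] by rewrite in_itv/= lexx ltW.
rewrite lt_neqAle hm// andbT; apply/eqP => e.
by apply: (nomax y) => // t /hm; rewrite e.
Qed.

Lemma cup_bounds s : c < s -> s <= s0 -> -1 <= a s < c.
Proof.
case: hcup => _ _ ac as0 _ cs ss0.
rewrite -[X in _ < X]ac cup_decreasing ?lexx// andbT -as0.
move: ss0; rewrite le_eqVlt => /predU1P[->//|ss0].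
by apply: ltW; apply: cup_decreasing => //; exact: ltW.
Qed.

Lemma cup_lt s : c < s -> s <= s0 -> [/\ -1 <= a s, a s < s, a s < 1 & s < 1].
Proof.
move=> cs ss0; have /andP[a1 ac] := cup_bounds cs ss0; have s1 := s0_lt1.
by have [_ c1] := andP c_bounds; split; lra.
Qed.

Lemma cup_denom s : c < s -> s <= s0 -> 0 < g1 s - g1 (a s).
Proof.
by move=> cs ss0; have [_ as_ _ s1] := cup_lt cs ss0; rewrite subr_gt0; exact: g1_incr.
Qed.

Lemma slopeE s : c < s -> s <= s0 -> slope s = (f1 s - f1 (a s)) / (g1 s - g1 (a s)).
Proof.
move=> cs ss0; have [_ _ a1 s1] := cup_lt cs ss0.
by rewrite /slope !derive1_f !derive1_g.
Qed.

(** The tangents at [a s] and s are parallel by the choice of [slope s]; the vanishing determinant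
    says that they coincide. *)
Lemma cup_bitangent s : c < s -> s <= s0 -> bitangent (a s) s (slope s) (intercept s).
Proof.
move=> cs ss0; have [_ _ a1 s1] := cup_lt cs ss0; have d0 := cup_denom cs ss0.
case: hcup => _ _ _ _ hdet; have := hdet s; rewrite (ltW cs) ss0 => /(_ isT).
rewrite det_cup_matrix// => e.
have hA : f1 (a s) - slope s * g1 (a s) = intercept s.
  by rewrite /intercept slopeE//; field; rewrite gt_eqF.
split => //; apply/eqP; rewrite -subr_eq0 -(mulrI_eq0 _ (lregP (lt0r_neq0 d0))); apply/eqP.
rewrite -[RHS]oppr0 -[in RHS]e /intercept slopeE//.
by field; rewrite gt_eqF.
Qed.

(** Up to sign, R is the value of the bitangent line at z, so [Rfun s z = 0] says that z is its
    root. *)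
Lemma Rfun_line s z : c < s -> s <= s0 ->
  Rfun s z = - (f s - slope s * g s + intercept s * (z - s)).
Proof.
move=> cs ss0; have [_ _ a1 s1] := cup_lt cs ss0; have d0 := cup_denom cs ss0.
rewrite /Rfun /intercept slopeE// !derive1_f !derive1_g//.
by field; rewrite gt_eqF.
Qed.

(** Here [slope c] is 0 / 0 = 0 and R reduces to - f c, so s1 = c is never a spurious solution. *)
Lemma Rfun_c z : Rfun c z < 0.
Proof.
have [c1 c2] := andP c_bounds; case: hcup => _ _ ac _ _.
rewrite /Rfun /slope ac !subrr !invr0 !mulr0 !mul0r subr0 addr0 oppr_lt0.
by rewrite f_phi// mulr_gt0 ?g_gt0// phi_gt0// ratio_gt0.
Qed.

Lemma cup_admissible s z : c < s -> s <= s0 -> -1 < z < 1 -> Rfun s z = 0 ->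
  admissible z (slope s) (intercept s).
Proof.
move=> cs ss0 z1; have [am as_ a1 s1] := cup_lt cs ss0.
rewrite Rfun_line// => /eqP; rewrite oppr_eq0 addr_eq0 => /eqP e.
apply: (bitangent_admissible hp T0 am as_ s1 z1 (cup_bitangent cs ss0)).
by rewrite e; ring.
Qed.

Lemma continuous_Rfun z m : c < m -> m <= s0 -> {within `[m, s0], continuous (Rfun ^~ z)}.
Proof.
move=> cm ms0; case: hcup => ca _ _ _ _.
have am : {within `[m, s0], continuous a}.
  apply: continuous_subspaceW ca => t; rewrite /= !in_itv/= => /andP[mt ->].
  by rewrite (le_trans (ltW cm) mt).
apply/subspace_continuousP => x xm.
have cts t : t < 1 -> [/\ {for t, continuous f}, {for t, continuous g},
    {for t, continuous f1} & {for t, continuous g1}].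
  move=> t1; have r0 := radius2_gt0T t T0.
  split.
  - exact: is_derive_continuous (@is_derive_f R p tau t r0).
  - exact: is_derive_continuous (@is_derive_g R p t t1).
  - exact: is_derive_continuous (@is_derive_f1 R p tau t r0).
  - exact: is_derive_continuous (@is_derive_g1 R p t t1).
have [cx xs0] : c < x /\ x <= s0.
  by move: xm; rewrite /= in_itv/= => /andP[mx ->]; split => //; exact: lt_le_trans mx.
have [_ _ a1 x1] := cup_lt cx xs0; have d0 := cup_denom cx xs0.
pose FF := within `[m, s0]%classic (nbhs x).
have ax : a @ FF --> a x by move/subspace_continuousP : am; exact.
have idx : id @ FF --> x by exact: cvg_within.
have [f_x g_x f1_x g1_x] := cts x x1; have [_ _ f1_a g1_a] := cts (a x) a1.
have filF : Filter FF by exact: within_filter.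
have Cf : f t @[t --> FF] --> f x by exact: (continuous_cvg _ f_x idx).
have Cg : g t @[t --> FF] --> g x by exact: (continuous_cvg _ g_x idx).
have Cf1 : f1 t @[t --> FF] --> f1 x by exact: (continuous_cvg _ f1_x idx).
have Cg1 : g1 t @[t --> FF] --> g1 x by exact: (continuous_cvg _ g1_x idx).
have Cfa : f1 (a t) @[t --> FF] --> f1 (a x) by exact: (continuous_cvg _ f1_a ax).
have Cga : g1 (a t) @[t --> FF] --> g1 (a x) by exact: (continuous_cvg _ g1_a ax).
have E t : c < t -> t <= s0 -> Rfun t z = - f t -
    (f1 (a t) * g1 t - f1 t * g1 (a t)) / (g1 t - g1 (a t)) * (z - t) +
    (f1 t - f1 (a t)) / (g1 t - g1 (a t)) * g t.
  move=> ct ts0; have [_ _ at1 t1] := cup_lt ct ts0.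
  by rewrite /Rfun slopeE// !derive1_f !derive1_g.
suff : (fun t => Rfun t z) @ FF --> Rfun x z by [].
rewrite E//.
have Cden : (g1 t - g1 (a t))^-1 @[t --> FF] --> (g1 x - g1 (a x))^-1.
  exact: (cvgV (lt0r_neq0 d0) (cvgB Cg1 Cga)).
have Cnum : f1 t - f1 (a t) @[t --> FF] --> f1 x - f1 (a x) by exact: (cvgB Cf1 Cfa).
have Cnum2 : f1 (a t) * g1 t - f1 t * g1 (a t) @[t --> FF] -->
    f1 (a x) * g1 x - f1 x * g1 (a x).
  exact: (cvgB (cvgM Cfa Cg1) (cvgM Cf1 Cga)).
have Cz : z - t @[t --> FF] --> z - x by apply: cvgB => //; exact: cvg_cst.
apply: (@cvg_trans _ ((fun t => - f t -
    (f1 (a t) * g1 t - f1 t * g1 (a t)) / (g1 t - g1 (a t)) * (z - t) +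
    (f1 t - f1 (a t)) / (g1 t - g1 (a t)) * g t) @ FF)); last first.
  exact: (cvgD (cvgB (cvgN Cf) (cvgM (cvgM Cnum2 Cden) Cz)) (cvgM (cvgM Cnum Cden) Cg)).
apply: near_eq_cvg; rewrite /FF; near=> t.
have : t \in `[m, s0] by near: t; apply: withinT.
by rewrite in_itv/= => /andP[mt ts0]; rewrite E//; exact: lt_le_trans mt.
Unshelve. all: by end_near. Qed.

(** * The three ranges of the root z *)

Local Notation t0 := (-1 + 2 / p).
Variable sstar : R.
Hypothesis t0_lt_s0 : t0 < s0.
Hypothesis hsstar : is_sstar p tau s0 c a sstar.

Lemma t0_bounds : 0 < t0 < 1.
Proof.
have [p1 p2] := andP hp.
have -> : -1 + 2 / p = (2 - p) / p by field; lra.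
by rewrite divr_gt0 ?ltr_pdivrMr//=; lra.
Qed.

Lemma sstar_lt1 : 0 < sstar < 1.
Proof.
have [t00 t01] := andP t0_bounds; have s01 := s0_lt1.
case: hsstar => /andP[h1 h2] _ _; lra.
Qed.

Lemma slope_sstar : slope sstar = phi (ratio sstar).
Proof.
have [_ s1] := andP sstar_lt1; case: hsstar => _ _ ->.
by rewrite f_phi// mulrAC mulfV ?mul1r// gt_eqF// g_gt0.
Qed.

Lemma c_lt_sstar : c < sstar.
Proof.
have [s_0 s_1] := andP sstar_lt1; case: hsstar => _ cs _.
rewrite lt_neqAle cs andbT; apply/eqP => e; have := slope_sstar.
case: hcup => _ _ ac _ _; rewrite -e /slope ac !subrr mul0r => h.
have : 0 < phi (ratio c) by apply: phi_gt0; apply: ratio_gt0; rewrite e; lra.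
by rewrite -h ltxx.
Qed.

Lemma sstar_le_s0 : sstar <= s0.
Proof. by case: hsstar => /andP[]. Qed.

Lemma Rfun_sstar z : Rfun sstar z = intercept sstar * (sstar - z).
Proof.
have [_ s1] := andP sstar_lt1.
rewrite Rfun_line ?c_lt_sstar ?sstar_le_s0//.
have -> : f sstar - slope sstar * g sstar = 0.
  by rewrite slope_sstar f_phi// mulrC subrr.
ring.
Qed.

Lemma sstar_admissible : admissible sstar (slope sstar) (intercept sstar).
Proof.
have [s_0 s_1] := andP sstar_lt1.
apply: cup_admissible; rewrite ?c_lt_sstar ?sstar_le_s0//; first lra.
by rewrite Rfun_sstar subrr mulr0.
Qed.

(** The cup at [sstar] touches the curve at the root of its own line, so the line is the tangent
    from which [admissible_extend] starts. *)
Lemma optimal_ge_sstar z : sstar <= z -> z < 1 -> optimal z (phi (ratio z)).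
Proof.
move=> sz z1; have [s_0 s_1] := andP sstar_lt1.
have [am as_ _ _] := cup_lt c_lt_sstar sstar_le_s0.
have [dom hr _ _] := bitangent_dominates hp T0 am as_ s_1 (cup_bitangent c_lt_sstar sstar_le_s0).
apply: (@optimal_touching _ _ _ z (f1 z - phi (ratio z) * g1 z)); first lra.
apply: (@admissible_extend _ _ _ hp sstar) => //; first lra.
- move=> t /dom; rewrite slope_sstar /intercept slope_sstar (f_phi _ _ s_1).
  by rewrite (mulrC (g sstar)) subrr add0r.
- by move=> t /hr; rewrite slope_sstar.
Qed.

Let a_s0 : a s0 = -1. Proof. by case: hcup. Qed.

(** The left contact point is -1, where f and g both satisfy h' = -(p / 2) h; so does f - K g, and
    its tangent there vanishes at -1 + 2 / p. *)
Lemma Rfun_s0 z : Rfun s0 z = intercept s0 * (t0 - z).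
Proof.
have [p1 p2] := andP hp; have s01 := s0_lt1.
have cs := cup_c_lt_s0; have [ha _ hv] := cup_bitangent cs (lexx s0).
rewrite a_s0 in ha hv; rewrite Rfun_line//.
have T4 : radius2 tau (-1) = 4 * T by rewrite /radius2; ring.
have r0 : 0 < radius2 tau (-1) by exact: radius2_gt0T.
have f1E : f1 (-1) = - (p / 2) * f (-1).
  rewrite /f1 /Defs.f -/(radius2 tau (-1)).
  have -> : p / 2 = p / 2 - 1 + 1 by ring.
  rewrite powRS// T4 (_ : p / 2 - 1 + 1 - 1 = p / 2 - 1); last by ring.
  by set W := _ `^ _; field.
have g1E : g1 (-1) = - (p / 2) * g (-1).
  rewrite /g1 /Defs.g (_ : 1 - -1 = 2 :> R); last by ring.
  have -> : p = p - 1 + 1 by ring.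
  rewrite [in RHS]powRS// (_ : p - 1 + 1 - 1 = p - 1); last by ring.
  by set W := _ `^ _; field.
have e : intercept s0 = - (p / 2) * (f (-1) - slope s0 * g (-1)).
  by rewrite -ha f1E g1E; ring.
have hv' : f (-1) - slope s0 * g (-1) = - (2 / p) * intercept s0.
  by rewrite e; field; lra.
have -> : f s0 - slope s0 * g s0 = intercept s0 * (s0 - -1) - 2 / p * intercept s0.
  by rewrite -hv hv'; ring.
ring.
Qed.

Lemma s0_admissible : admissible t0 (slope s0) (intercept s0).
Proof.
have [t00 t01] := andP t0_bounds.
apply: cup_admissible; rewrite ?cup_c_lt_s0 ?lexx//; first lra.
by rewrite Rfun_s0 subrr mulr0.
Qed.

Lemma optimal_t0 : optimal t0 (slope s0).
Proof.
have [t00 t01] := andP t0_bounds; have cs := cup_c_lt_s0.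
have := Rfun_s0 t0; rewrite subrr mulr0 Rfun_line// => /eqP.
rewrite oppr_eq0 addr_eq0 => /eqP e.
apply: (bitangent_optimal hp T0 _ _ t0_lt_s0 s0_lt1 _ (cup_bitangent cs (lexx s0))).
- by rewrite a_s0.
- by rewrite a_s0; lra.
- lra.
- by rewrite e; ring.
Qed.

(* If s < sstar, the contact points are nested between those of the line through
   [sstar], so that K is at least phi (ratio s), contradicting z < s.  If
   sstar < s, the function [rho - phi] is nonnegative somewhere to the right of
   a s, hence positive at a s, where [rho] is at most K. *)
Lemma contact_lt_root s z : t0 < z -> z < sstar -> z < s -> c < s -> s <= s0 ->
  Rfun s z = 0 -> a s < z.
Proof.
move=> tz zss zs cs ss0 R0; have [t00 t01] := andP t0_bounds.
have [s_0 s_1] := andP sstar_lt1.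
have z1 : -1 < z < 1 by lra.
have [am as_ a1 s1] := cup_lt cs ss0.
have [bm bs b1 _] := cup_lt c_lt_sstar sstar_le_s0.
have adm := cup_admissible cs ss0 z1 R0.
have A0 := admissible_slope_gt0 hp (andP z1).2 adm.
have As0 := admissible_slope_gt0 hp s_1 sstar_admissible.
have bt := cup_bitangent cs ss0; have bts := cup_bitangent c_lt_sstar sstar_le_s0.
have [dom _ rho_a _] := bitangent_dominates hp T0 am as_ s1 bt.
have [doms _ _ [al /andP[al1 al2] rho_al]] := bitangent_dominates hp T0 bm bs s_1 bts.
have line t : f s - slope s * g s + intercept s * (t - s) = intercept s * (t - z).
  move: R0; rewrite Rfun_line// => /eqP; rewrite oppr_eq0 addr_eq0 => /eqP ->; ring.
have fa : f (a s) - slope s * g (a s) = intercept s * (a s - z).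
  case: bt => _ _ e; rewrite -line.
  have : intercept s * (a s - s) = - (intercept s * (s - a s)) by ring.
  by rewrite -e => ->; ring.
have [sss|sss|se] := ltgtP s sstar; last first.
- move: R0; rewrite se Rfun_sstar => /eqP; rewrite mulf_eq0 gt_eqF//= subr_eq0 => /eqP e.
  by rewrite e ltxx in zss.
- have ab : a s < a sstar by apply: cup_decreasing => //; exact: ltW c_lt_sstar.
  have c_al : 0 <= contact (ratio al).
    have al_1 : al < 1 by exact: lt_trans s_1.
    have ral : 0 <= ratio al by apply: ratio_ge0 => //; exact: le_trans bm (ltW al1).
    have [<- _] := phi_rho_contact T0 ral; rewrite rho_al slope_sstar.
    by apply: ler_phi => //; apply: ltW; exact: ltr_ratio.
  have ras : 0 <= ratio (a s) by exact: ratio_ge0.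
  have c_as : 0 < contact (ratio (a s)).
    apply: contact_gt0 c_al => //; apply: ltr_ratio; first exact: lt_trans al1.
    exact: lt_trans s_1.
  have : phi (ratio (a s)) < rho (ratio (a s)) by have [_ ->] := phi_rho_contact T0 ras.
  move=> /lt_le_trans/(_ rho_a) phiK.
  have : f (a s) - slope s * g (a s) < 0.
    by rewrite f_phi// mulrC -mulrBl pmulr_llt0 ?subr_lt0// g_gt0.
  by rewrite fa pmulr_rlt0// subr_lt0.
have ab : a sstar < a s by apply: cup_decreasing => //; [exact: ltW|exact: sstar_le_s0].
have KK : slope sstar <= slope s.
  have lineE K A u t : f u - K * g u + A * (t - u) = (f u - K * g u - A * u) + A * t by ring.
  apply: (@nested_contact (a sstar) (a s) sstar (slope s) (- (intercept s * z))
    (intercept s) (slope sstar) (f sstar - slope sstar * g sstar - intercept sstar * sstar)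
    (intercept sstar)) => //.
  - exact: lt_trans sss.
  - by rewrite fa; ring.
  - have := dom (a sstar); rewrite bm b1 line => /(_ isT)/le_trans; apply.
    by rewrite le_eqVlt; apply/orP; left; apply/eqP; ring.
  - have := dom sstar; rewrite s_1 line (le_trans bm (ltW bs)) => /(_ isT)/le_trans; apply.
    by rewrite le_eqVlt; apply/orP; left; apply/eqP; ring.
  - by have := doms (a s); rewrite am a1 lineE => /(_ isT).
  - case: bts => _ _ e.
    by rewrite -[LHS](subKr (f sstar - slope sstar * g sstar)) e; ring.
  - by ring.
have : 0 < intercept s * (s - z) by rewrite mulr_gt0// subr_gt0.
rewrite -line subrr mulr0 addr0 f_phi// mulrC -mulrBl pmulr_lgt0 ?g_gt0// subr_gt0.
move=> /lt_le_trans h; exfalso.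
have : phi (ratio s) <= slope s.
  apply: le_trans KK; rewrite slope_sstar; apply: ler_phi => //;
    last by apply: ltW; exact: ltr_ratio.
  by apply: ratio_ge0 => //; exact: le_trans am (ltW as_).
by move=> /h; rewrite ltxx.
Qed.

Lemma optimal_mid s z : t0 < z -> z < sstar -> z < s -> s < s0 -> c <= s ->
  Rfun s z = 0 -> optimal z (slope s).
Proof.
move=> tz zss zs ss0; rewrite le_eqVlt => /predU1P[<-|cs] R0.
  by have := Rfun_c z; rewrite R0 ltxx.
have [t00 t01] := andP t0_bounds; have [s_0 s_1] := andP sstar_lt1.
have [am as_ a1 s1] := cup_lt cs (ltW ss0).
have az := contact_lt_root tz zss zs cs (ltW ss0) R0.
move: R0; rewrite Rfun_line ?(ltW ss0)// => /eqP; rewrite oppr_eq0 addr_eq0 => /eqP e.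
apply: (bitangent_optimal hp T0 am az zs s1 _ (cup_bitangent cs (ltW ss0))); first lra.
by rewrite e; ring.
Qed.

(** R has the sign of sstar - z at [sstar] and of t0 - z at [s0], so it changes sign in between. *)
Lemma exists_root z : t0 < z -> z < sstar ->
  exists s, [/\ z < s < s0, c <= s & Rfun s z = 0].
Proof.
move=> tz zss; have [t00 t01] := andP t0_bounds; have [s_0 s_1] := andP sstar_lt1.
have As := admissible_slope_gt0 hp s_1 sstar_admissible.
have A0 := admissible_slope_gt0 hp t01 s0_admissible.
have R1 : 0 < Rfun sstar z by rewrite Rfun_sstar mulr_gt0// subr_gt0.
have R2 : Rfun s0 z < 0 by rewrite Rfun_s0 pmulr_rlt0// subr_lt0.
have [|s] := @IVT _ _ _ _ 0 sstar_le_s0 (@continuous_Rfun z sstar c_lt_sstar sstar_le_s0).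
  by rewrite ge_min le_max (ltW R1) (ltW R2) orbT.
rewrite in_itv/= => /andP[s1 s2] R0.
exists s; split => //; last exact: le_trans (ltW c_lt_sstar) s1.
rewrite (lt_le_trans zss s1) lt_neqAle s2 andbT; apply/eqP => e.
by move: R2; rewrite -e R0 ltxx.
Qed.

(** The slope A of the line is computed twice: from the contact at s0 and the root [t0] ([AE], then
    [key]), and from the value at -1 ([A2]). Eliminating A leaves a linear equation for K. *)
Lemma slope_s0 : slope s0 = `|tau| `^ p /
  (1 - 2 `^ (2 - p) * (1 - s0) `^ (p - 1) /
     ((T + 1) * (p - 1) * (1 - s0) + 2 * (2 - p))).
Proof.
have [p1 p2] := andP hp; have [t00 t01] := andP t0_bounds.
have s01 := s0_lt1; have s00 : 0 < s0 by have := t0_lt_s0; lra.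
have cs := cup_c_lt_s0; have [ha hs hv] := cup_bitangent cs (lexx s0).
rewrite a_s0 in ha hv.
set A := intercept s0 in ha hs hv; set K := slope s0 in ha hs hv *.
have r0 : 0 < radius2 tau s0 by exact: radius2_gt0T.
have y0 := ratio_gt0 _ s01; have {}y0 : 0 < ratio s0 by apply: y0; lra.
set y := ratio s0 in y0.
have Q0 : 0 < T + y ^+ 2 by rewrite ltr_wpDr ?sqr_ge0.
have s10 : 0 < 1 - s0 by lra.
pose W := (1 - s0) `^ (p - 2); pose X := (T + y ^+ 2) `^ (p / 2 - 1).
have W0 : 0 < W by rewrite powR_gt0.
have X0 : 0 < X by rewrite powR_gt0.
have gE : g s0 = (1 - s0) ^+ 2 * W.
  rewrite /Defs.g (_ : p = p - 2 + 1 + 1); last by ring.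
  by rewrite !powRS// -/W expr2 mulrA.
have g1E : g1 s0 = - p * ((1 - s0) * W).
  rewrite /g1 (_ : p - 1 = p - 2 + 1); last by ring.
  by rewrite powRS.
have phiE : phi y = (T + y ^+ 2) * X.
  by rewrite /phi /X -powRS//; congr (_ `^ _); ring.
have h1 := @f1_phi R p tau s0 s01 r0; rewrite -/y -/W -/X in h1.
have h2 : f s0 - K * g s0 = A * (s0 - t0).
  have := Rfun_s0 s0; rewrite Rfun_line// -/K -/A subrr mulr0 addr0 => e.
  by rewrite -[LHS]opprK e; ring.
rewrite f_phi// -/y in h2.
have yE : y * (1 - s0) = 1 + s0 by rewrite /y /ratio divfK// gt_eqF.
have AE : A * (p - 1) = 2 * p * W * X.
  have h3 : A * (1 - s0) = 2 * W * (p * y * X) * (1 - s0) - p * (A * (s0 - t0)).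
    by rewrite -hs -h2 -h1 gE g1E; ring.
  have h4 : A * (p - 1) * (1 + s0) = 2 * p * W * X * (1 + s0).
    have -> : A * (p - 1) * (1 + s0) = A * (1 - s0) + p * (A * (s0 - t0)) by field; lra.
    by rewrite h3 -yE; ring.
  by apply: (mulIf _ h4); rewrite gt_eqF//; lra.
have f_1 : f (-1) = 2 `^ p * `|tau| `^ p.
  rewrite /Defs.f (_ : (1 + -1) ^+ 2 + T * (1 - -1) ^+ 2 = (2 * `|tau|) ^+ 2); last first.
    by rewrite exprMn real_normK ?num_real//; ring.
  rewrite powR_sqr ?mulr_ge0//.
  have -> : 2 * (p / 2) = p by field.
  by rewrite powRM.
have g_1 : g (-1) = 2 `^ p by rewrite /Defs.g; congr (_ `^ _); ring.
set tp := `|tau| `^ p in f_1 *.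
have tp0 : 0 < tp.
  by rewrite /tp powR_gt0// normr_gt0 -sqrf_eq0 gt_eqF.
have A2 : A = p / 2 * (2 `^ p * (K - tp)).
  have := Rfun_s0 (-1); rewrite Rfun_line// -/K -/A => e.
  have e2 : f s0 - K * g s0 = f (-1) - K * g (-1) + A * (s0 - -1) by rewrite -hv; ring.
  move: e; rewrite e2 f_1 g_1 => e.
  have e3 : A * (2 / p) = 2 `^ p * (K - tp).
    have : A * (t0 - -1) = A * (2 / p) by ring.
    by rewrite -e => <-; ring.
  by rewrite -e3; field; lra.
pose N := (T + 1) * (p - 1) * (1 - s0) + 2 * (2 - p).
have N0 : 0 < N.
  have : 0 <= (T + 1) * (p - 1) * (1 - s0) by rewrite !mulr_ge0//; have := T0; lra.
  rewrite /N; lra.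
have key : A * N = 2 * p * ((1 - s0) * W) * K.
  have h5 : (1 - s0) ^+ 2 * W * ((T + y ^+ 2) * X) - K * ((1 - s0) ^+ 2 * W) = A * (s0 - t0).
    by rewrite -h2 gE phiE.
  have h6 : A * (p - 1) * ((1 - s0) ^+ 2 * (T + y ^+ 2)) - 2 * p * (A * (s0 - t0)) =
     2 * p * ((1 - s0) ^+ 2 * W * K).
    by rewrite AE -h5; ring.
  have h7 : (1 - s0) ^+ 2 * (T + y ^+ 2) = (1 + s0) ^+ 2 + T * (1 - s0) ^+ 2.
    by rewrite -yE; ring.
  rewrite h7 in h6.
  apply: (@mulIf _ (1 - s0)); first by rewrite gt_eqF.
  transitivity (A * (p - 1) * ((1 + s0) ^+ 2 + T * (1 - s0) ^+ 2) - 2 * p * (A * (s0 - t0))).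
    by rewrite /N; field; lra.
  by rewrite h6; ring.
have W1 : (1 - s0) `^ (p - 1) = (1 - s0) * W.
  by rewrite -powRS//; congr (_ `^ _); ring.
have P2 : 2 `^ (2 - p) * 2 `^ p = 4 :> R.
  rewrite -powRD; last by rewrite pnatr_eq0 implybT.
  by rewrite (_ : 2 - p + p = 2) ?powR_mulrn//; ring.
have key2 : (K - tp) * N = 2 `^ (2 - p) * ((1 - s0) * W) * K.
  have e : 2 `^ p * ((K - tp) * N) = 4 * ((1 - s0) * W) * K.
    apply: (@mulfI _ (p / 2)); first by rewrite mulf_neq0 ?invr_eq0 ?gt_eqF//; lra.
    transitivity (A * N); first by rewrite A2; ring.
    by rewrite key; field.
  apply: (@mulfI _ (2 `^ p)); first by rewrite gt_eqF// powR_gt0.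
  by rewrite e -P2; ring.
rewrite -/N W1; set B := 2 `^ (2 - p) * _ in key2 *.
have NBK : K * (N - B) = tp * N.
  have -> : K * (N - B) = (K - tp) * N + tp * N - B * K by ring.
  by rewrite key2; ring.
have NB : N - B != 0.
  by apply/eqP => e; move: NBK; rewrite e mulr0 => /esym/eqP; rewrite gt_eqF// mulr_gt0.
have -> : 1 - B / N = (N - B) / N by field; rewrite gt_eqF.
by rewrite invf_div mulrA -NBK mulfK.
Qed.

End CupFunction.

End Cup.

(** * Conclusion *)

Theorem theorem2 (R : realType) (p tau : R) (hp : 1 < p < 2) :
  (u p tau (1 / (p - 1)) <= 0 ->
   forall beta : R, 0 <= beta ->
     transform_bound p tau beta
       ((tau ^+ 2 + Num.max beta (1 / (p - 1)) ^+ 2) `^ (p / 2)))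
  /\
  (0 < u p tau (1 / (p - 1)) ->
   forall (s0 c : R) (a : R -> R) (sstar : R),
     is_s0 p tau s0 ->
     is_cup_origin p tau c ->
     is_cup_function p tau c s0 a ->
     is_sstar p tau s0 c a sstar ->
   exists C : R -> R,
     [/\ is_constant p tau s0 c a sstar C,
         {within `[-1, 1[, continuous C},
         {in `[-1, 1[ &, {homo C : x y / x <= y}}
       & forall beta : R, 0 <= beta ->
           transform_bound p tau beta (C ((beta - 1) / (beta + 1)))]).
Proof.
split; first by move=> u0 beta; exact: case_i_transform.
move=> u0 s0 c a sstar [/andP[t0s0 s01] _] [c1 _ _] hcup hss.
have T0 := u_gt0_tau hp u0.
have [/andP[t0ss ss0] css _] := hss.
have cs0 : c <= s0 by exact: le_trans ss0.
have [t00 t01] := andP (t0_bounds hp).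
have o_t0 : optimal p tau (-1 + 2 / p) (slope p tau a s0).
  exact: (optimal_t0 hp T0 c1 s01 cs0 hcup t0s0).
have o_ge z : sstar <= z -> z < 1 -> optimal p tau z (phi p tau (ratio z)).
  by move=> sz z1; exact: (optimal_ge_sstar hp T0 c1 s01 hcup hss sz z1).
have o_mid s z : -1 + 2 / p < z -> z < sstar -> z < s -> s < s0 -> c <= s ->
    Rfun p tau a s z = 0 -> optimal p tau z (slope p tau a s).
  exact: (optimal_mid hp T0 c1 s01 hcup hss).
have root z : -1 + 2 / p < z -> z < sstar ->
    exists s, [/\ z < s < s0, c <= s & Rfun p tau a s z = 0].
  exact: (exists_root hp T0 c1 s01 cs0 hcup hss).
have ex z : -1 + 2 / p <= z < 1 -> exists K, optimal p tau z K.
  move=> /andP[]; rewrite le_eqVlt => /predU1P[<- _|tz z1]; first by exists (slope p tau a s0).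
  have [zs|sz] := ltP z sstar; last by exists (phi p tau (ratio z)); exact: o_ge.
  have [s [/andP[zs1 ss1] cs R0]] := root z tz zs.
  by exists (slope p tau a s); exact: o_mid.
pose C z := optimal_constant p tau (Num.max z (-1 + 2 / p)).
have CE z K : -1 + 2 / p <= z -> optimal p tau z K -> C z = K.
  by move=> tz oK; rewrite /C max_l//; exact: optimal_constantE.
have oC z : z < 1 -> optimal p tau (Num.max z (-1 + 2 / p)) (C z).
  move=> z1; have [|K oK] := ex (Num.max z (-1 + 2 / p)).
    by rewrite le_max lexx orbT gt_max z1.
  by rewrite /C (optimal_constantE oK).
have b_lt1 (beta : R) : 0 <= beta -> (beta - 1) / (beta + 1) < 1.
  by move=> b0; rewrite ltr_pdivrMr; lra.
exists C; split.
- move=> beta b0 /=; set z := (beta - 1) / (beta + 1); have z1 : z < 1 by exact: b_lt1.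
  split.
  + move=> sz; rewrite (CE z _ _ (o_ge z sz z1)); last exact: le_trans sz.
    by rewrite /phi (_ : ratio z = beta)// /ratio /z; field; lra.
  + move=> zt; rewrite /C max_r// (optimal_constantE o_t0).
    exact: (slope_s0 hp T0 c1 s01 cs0 hcup t0s0).
  + move=> /andP[tz zss]; split.
      have [s [h1 h2 h3]] := root z tz zss; by exists s.
    (* Any solution s1 gives a minimal K for z, so [C z] is its slope whichever solution is
       taken. *)
    move=> s /andP[zs ss1] cs R0; apply: CE; first exact: ltW.
    exact: o_mid.
- apply: continuous_in_subspaceT => x; rewrite inE/= in_itv/= => /andP[_ x1].
  by apply: continuous_optimal => //; rewrite ltW.
- move=> x y; rewrite !in_itv/= => /andP[_ x1] /andP[_ y1] xy.
  apply: (optimal_ndecr hp _ _ (oC x x1) (oC y y1)).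
    by rewrite ge_max !le_max xy lexx orbT.
  by rewrite gt_max y1.
- move=> beta b0; have z1 := b_lt1 beta b0; set z := (beta - 1) / (beta + 1) in z1 *.
  have m1 : -1 + 2 / p <= Num.max z (-1 + 2 / p) < 1.
    by rewrite le_max lexx orbT gt_max z1.
  have [[A adm] _] := oC z z1.
  have C0 : 0 < C z by apply: (admissible_gt0 _ adm); case/andP: m1 => h ->; lra.
  apply: (admissible_transform hp m1 C0 adm b0).
  by rewrite -/z le_max lexx.
Qed.
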